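(* Let $p$ be a prime, let $d\ge2$, and let $P^\perp$ be a linear cellular automaton shift over $\mathbb F_p$ in $d$ variables, given by $P=X_d-\Phi(X_1,\ldots,X_{d-1})$. Then the automorphism group of $P^\perp$ (under composition) is a finitely generated abelian group.
   Context: Identify $(c_{\mathbf n})_{\mathbf n\in\mathbb Z^d}\in\mathbb F_p^{\mathbb Z^d}$ with the formal (two-sided) Laurent series $\sum_{\mathbf n\in\mathbb Z^d}c_{\mathbf n}X^{\mathbf n}$, where $X^{\mathbf n}=X_1^{n_1}\cdots X_d^{n_d}$. The set $\mathbb F_p[[X_1^{\pm1},\ldots,X_d^{\pm1}]]$ of all such series, with the product topology ($\mathbb F_p$ discrete), is a compact abelian group and a module over the ring $\mathbb F_p[X_1^{\pm1},\ldots,X_d^{\pm1}]$ of Laurent polynomials. The group $\mathbb Z^d$ acts by $T_{\mathbf n}x=X^{\mathbf n}x$; the shift $\sigma_i$ is multiplication by $X_i^{-1}$. For a Laurent polynomial $P$, $P^\perp=\{x\in\mathbb F_p[[X_1^{\pm1},\ldots,X_d^{\pm1}]]: Px=0\}$, a closed submodule. $P^\perp$ is a linear cellular automaton shift if $P=X_d-\Phi(X_1,\ldots,X_{d-1})$, where $\Phi$ is a Laurent polynomial in $X_1,\ldots,X_{d-1}$ over $\mathbb F_p$ with at least two non-zero terms. An automorphism of $P^\perp$ is a $\mathbb Z^d$-equivariant homeomorphism $\phi\colon P^\perp\to P^\perp$ with $\phi(0)=0$ (not assumed additive). *)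

(* Defs.v *)
From HB Require Import structures.
From mathcomp Require Import all_boot all_algebra finmap monalg.
From mathcomp Require Import boolp classical_sets functions.
From mathcomp Require Import topology function_spaces subtype_topology.

Set Implicit Arguments.
Unset Strict Implicit.
Unset Printing Implicit Defensive.

Import GRing.Theory.

Local Open Scope classical_set_scope.
Local Open Scope ring_scope.

(* Exponents are row vectors k : 'rV[int]_d; the variable X_i of the
   mathematical text has index i - 1 in 'I_d. *)
Definition laurent (p d : nat) := {malg 'F_p['rV[int]_d]}.

Definition lmonom (p d : nat) (k : 'rV[int]_d) : laurent p d := << 1 *g k >>.

(* The variable X_d. *)
Definition lastX (p d : nat) : laurent p d :=
  lmonom p (\row_(i < d) (i.+1 == d)%:R).

Definition lift_exp (d : nat) (k : 'rV[int]_d.-1) : 'rV[int]_d :=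
  \row_(i < d) oapp (fun j : 'I_d.-1 => k 0 j) 0 (insub (val i)).

(* The inclusion of the Laurent polynomials in X_1, ..., X_{d-1} into those
   in X_1, ..., X_d. *)
Definition lift_laurent (p d : nat) (Phi : laurent p d.-1) : laurent p d :=
  \sum_(k <- msupp Phi) << Phi@_k *g lift_exp k >>.

(* X_d - Phi(X_1, ..., X_{d-1}). *)
Definition lca_poly (p d : nat) (Phi : laurent p d.-1) : laurent p d :=
  lastX p d - lift_laurent Phi.

Definition nb_terms (p d : nat) (Q : laurent p d) : nat := #|` msupp Q|.

Definition series (p d : nat) : Type := 'rV[int]_d -> 'F_p.

HB.instance Definition _ (p d : nat) :=
  GRing.Zmodule.copy (series p d) ('rV[int]_d -> 'F_p).
HB.instance Definition _ (p d : nat) :=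
  Topological.copy (series p d)
    {ptws 'rV[int]_d -> discrete_topology 'F_p}.

Definition lmul (p d : nat) (P : laurent p d) (x : series p d) : series p d :=
  fun m => \sum_(k <- msupp P) P@_k * x (m - k).

Definition perp (p d : nat) (P : laurent p d) : set (series p d) :=
  [set x | lmul P x = 0].

Definition act (p d : nat) (n : 'rV[int]_d) (x : series p d) : series p d :=
  lmul (lmonom p n) x.

Lemma actE (p d : nat) (n : 'rV[int]_d) (x : series p d) m :
  act n x m = x (m - n).
Proof.
rewrite /act /lmul /lmonom msuppU oner_eq0 big_seq_fset1.
by rewrite mcoeffU eqxx mul1r.
Qed.

Lemma perp_set0 (p d : nat) (P : laurent p d) : perp P 0.
Proof.
by apply/funext => m; rewrite /lmul big1 // => k _; rewrite mulr0.
Qed.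

Lemma perp_act (p d : nat) (P : laurent p d) n x : perp P x -> perp P (act n x).
Proof.
move=> Px; apply/funext => m; rewrite /lmul.
under eq_bigr do rewrite actE addrAC.
exact: (congr1 (fun y : series p d => y (m - n)) Px).
Qed.

(* [perp P] is used below as a type through the coercion [set_type]; it carries
   the topology induced by the product topology on [series p d]. *)
Definition perp0 (p d : nat) (P : laurent p d) : perp P :=
  SigSub (mem_set (perp_set0 P)).

Definition perp_T (p d : nat) (P : laurent p d) (n : 'rV[int]_d) (x : perp P) :
    perp P :=
  SigSub (mem_set (perp_act n (set_valP x))).

Definition homeomorphism (S T : topologicalType) (f : S -> T) : Prop :=
  exists g : T -> S,
    [/\ cancel f g, cancel g f, continuous f & continuous g].

Definition is_automorphism (p d : nat) (P : laurent p d)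
    (f : perp P -> perp P) : Prop :=
  [/\ homeomorphism f,
      forall n x, f (perp_T n x) = perp_T n (f x)
    & f (perp0 P) = perp0 P].

Record automorphism (p d : nat) (P : laurent p d) := Automorphism {
  aut_fun :> perp P -> perp P;
  aut_funP : is_automorphism aut_fun }.

HB.instance Definition _ (p d : nat) (P : laurent p d) :=
  gen_eqMixin (automorphism P).
HB.instance Definition _ (p d : nat) (P : laurent p d) :=
  gen_choiceMixin (automorphism P).

Section AutomorphismGroup.
Variables (p d : nat) (P : laurent p d).
Implicit Types f g h : automorphism P.

Lemma aut_ext f g : aut_fun f =1 aut_fun g -> f = g.
Proof.
case: f g => [f fP] [g gP] /= /funext efg; rewrite efg in fP *.
by rewrite (Prop_irrelevance fP gP).
Qed.

Lemma aut_id_subproof : is_automorphism (@id (perp P)).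
Proof. by split=> //; exists id; split=> // x; exact: cvg_id. Qed.

Lemma aut_comp_subproof f g : is_automorphism (f \o g).
Proof.
case: f g => [f [[f' [fK f'K cf cf']] fT f0]] [g [[g' [gK g'K cg cg']] gT g0]].
split=> /=; last by rewrite g0 f0.
- exists (g' \o f'); split=> /=.
  + exact: can_comp.
  + exact: can_comp.
  + by move=> x; apply: continuous_comp; [exact: cg|exact: cf].
  + by move=> x; apply: continuous_comp; [exact: cf'|exact: cg'].
- by move=> n x; rewrite gT fT.
Qed.

Lemma aut_inv_subproof f :
  exists g : automorphism P, cancel f g /\ cancel g f.
Proof.
case: f => [f [[f' [fK f'K cf cf']] fT f0]].
have f'P : is_automorphism f'.
  split; first by exists f.
  - by move=> n x; apply: (can_inj fK); rewrite fT !f'K.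
  - by apply: (can_inj fK); rewrite f'K f0.
by exists (Automorphism f'P).
Qed.

Definition aut_one : automorphism P := Automorphism aut_id_subproof.
Definition aut_mul f g : automorphism P :=
  Automorphism (aut_comp_subproof f g).
Definition aut_inv f : automorphism P := projT1 (cid (aut_inv_subproof f)).

Lemma aut_mulA : associative aut_mul.
Proof. by move=> f g h; apply: aut_ext. Qed.

Lemma aut_mul1 : left_id aut_one aut_mul.
Proof. by move=> f; apply: aut_ext. Qed.

Lemma aut_mulr1 : right_id aut_one aut_mul.
Proof. by move=> f; apply: aut_ext. Qed.

Lemma aut_mulV : left_inverse aut_one aut_inv aut_mul.
Proof.
by move=> f; apply: aut_ext => x; rewrite /= /aut_inv; case: cid => g [].
Qed.

Lemma aut_mulrV : right_inverse aut_one aut_inv aut_mul.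
Proof.
by move=> f; apply: aut_ext => x; rewrite /= /aut_inv; case: cid => g [].
Qed.

HB.instance Definition _ := isGroup.Build (automorphism P)
  aut_mulA aut_mul1 aut_mulr1 aut_mulV aut_mulrV.

End AutomorphismGroup.

Definition abelian_group (G : groupType) : Prop :=
  forall f g : G, (f * g = g * f)%g.

Definition finitely_generated_group (G : groupType) : Prop :=
  exists s : seq G, forall H : {pred G},
    group_closed H -> {subset s <= H} -> forall g, g \in H.

(* Main.v *)
Require Import Defs.
From mathcomp Require Import all_boot all_order all_algebra finmap monalg.
From mathcomp Require Import boolp classical_sets functions.
From mathcomp Require Import topology function_spaces subtype_topology.
From mathcomp Require Import zify ring.

(** The proof rests on two facts about a linear cellular automaton shift
    [perp P], [P = X_d - Phi].

    Rigidity: every continuous shift-equivariant map [F] fixing [0] is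
    multiplication by a Laurent polynomial ([equivariant_map_is_laurent]).  As
    [p] is the characteristic, every [x] killed by [X_d - Phi] is also killed by
    [X_d^q - sum_k Phi_k X^(q k)] for [q = p^j] ([frobenius_identity]).  By
    continuity [F x] at the origin only depends on [x] on a finite window, and
    every coordinate of a solution is determined by finitely many coordinates of
    any higher row (constant last exponent), so that window may be taken inside
    one row.  A row of a solution is arbitrary on finite sets: dividing by [Phi]
    along a generic linear functional yields a solution whose row of height [0]
    is the unit impulse ([fundamental_solution]).  For [q] large the translates
    of the window by the [- q k], [k] in the support of [Phi], are disjoint, so
    independent patterns can be put on two of them and [0] on the others;
    evaluating [F] through the identity above gives
    [F (a x + b y) = a F x + b F y] at the origin for the two coefficients
    [a], [b] ([additive_two_terms]).  So [F] is additive, and an additive local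
    rule is a Laurent polynomial.  Laurent polynomials commute, hence the
    automorphism group is abelian.

    Finite generation: on [perp P] the variable [X_d] acts as [Phi], so after
    multiplication by a power of a suitable [Psi], a polynomial in [X_1, ...,
    X_(d-1)] divisible by these variables and, up to a monomial, by [Phi], an
    automorphism [f] acts as a polynomial [a] in [X_1, ..., X_(d-1)], and [a]
    divides a power of [Psi] because [f] is invertible. The polynomial ring in
    [d - 1] variables over ['F_p] is built as an iterated ring of univariate
    polynomials, and by induction ([finite_val_rank_poly]) it carries, for each
    nonzero [Psi], finitely many additive valuations that determine a divisor
    of a power of [Psi] up to finitely many factors: orders at the irreducible
    factors of [Psi] over the fraction field, together with valuations of the
    leading coefficient. These yield finitely many homomorphisms from the
    automorphism group to the integers with finite common kernel, and such a
    group is finitely generated ([finitely_generated_of_homs]). *)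

Set Implicit Arguments.
Unset Strict Implicit.
Unset Printing Implicit Defensive.
Import Order.TTheory GRing.Theory Num.Theory.
Import Pdiv.CommonIdomain.
Local Open Scope ring_scope.

(** * Valuations on divisors of powers of a polynomial *)

Section FactorOrder.
Variable R : idomainType.
Implicit Types (p q a b : {poly R}).

Lemma irreducible_factor_exists p :
  (1 < size p)%N -> exists2 q, irreducible_poly q & q %| p.
Proof.
have [n] := ubnP (size p); elim: n p => // n IHn p /ltnSE-lepn p_gt1.
have p0 : p != 0 by rewrite -size_poly_gt0 ltnW.
have [[q [q_gt1 ltqp qp]]|irr_p] :=
  pselect (exists q, [/\ (1 < size q)%N, (size q < size p)%N & q %| p]).
  have [r irr_r rq] := IHn q (leq_trans ltqp lepn) q_gt1.
  by exists r => //; apply: dvdp_trans qp.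
exists p; last exact: dvdpp.
split=> // q q1 qp; rewrite -dvdp_size_eqp // eqn_leq dvdp_leq //= leqNgt.
apply/negP => ltqp; apply: irr_p; exists q; split=> //.
have q0 : q != 0 by apply: contraTneq qp => ->; rewrite dvd0p.
by rewrite ltn_neqAle eq_sym q1 size_poly_gt0.
Qed.

Lemma irreducible_coprime p a :
  irreducible_poly p -> ~~ (p %| a) -> coprimep p a.
Proof.
move=> irr_p; apply: contraR => ncop; rewrite coprimep_def in ncop.
have /eqp_dvdl<- := irr_p _ ncop (dvdp_gcdl _ _); exact: dvdp_gcdr.
Qed.

(** The exponent of [p] in [a].  Over an integral domain [%|] is divisibility
    over the fraction field; only the values at irreducible [p] and nonzero [a]
    matter. *)
Definition factor_order p a : nat := \max_(n < (size a).+1 | p ^+ n %| a) n.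

(** [factor_order] is read off any factorization, over the fraction field, by a
    power of [p] and a cofactor prime to [p]. *)
Lemma factor_order_eq p a q (c : R) n :
  irreducible_poly p -> a != 0 -> c != 0 -> c *: a = q * p ^+ n ->
  ~~ (p %| q) -> factor_order p a = n.
Proof.
move=> irr_p a0 c0 eqa npq.
have p0 := irredp_neq0 irr_p.
have dvE k : (p ^+ k %| a) = (k <= n)%N.
  rewrite -(eqp_dvdr _ (eqp_scale a c0)) eqa.
  have [lekn|ltnk] := leqP k n; first by rewrite dvdp_mull // dvdp_exp2l.
  rewrite -(subnK (ltnW ltnk)) exprD dvdp_mul2r ?expf_neq0 //.
  apply: contraNF npq; apply: dvdp_trans.
  by rewrite -[X in X %| _]expr1 dvdp_exp2l // subn_gt0.
have len : (n < (size a).+1)%N.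
  have := @dvdp_leq _ (p ^+ n) a a0; rewrite dvE leqnn => /(_ isT).
  have: (0 < size (p ^+ n))%N by rewrite size_poly_gt0 expf_neq0.
  move=> /prednK <-; rewrite size_exp => /ltnW/ltnSE len.
  rewrite ltnS; apply: leq_trans len; apply: leq_pmull.
  by rewrite -subn1 subn_gt0 irr_p.1.
apply/eqP; rewrite eqn_leq; apply/andP; split.
  by apply/bigmax_leqP => k; rewrite dvE.
by apply: (@leq_bigmax_cond _ _ _ (Ordinal len)); rewrite dvE.
Qed.

Lemma factor_order_exists p a : irreducible_poly p -> a != 0 ->
  exists c q n, [/\ c != 0, c *: a = q * p ^+ n & ~~ (p %| q)].
Proof.
move=> irr_p a0.
have [n] := ubnP (size a); elim: n a a0 => // n IHn a a0 /ltnSE-lean.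
have [/Pdiv.WeakIdomain.dvdpP[[c q] /= c0 eqa]|npa] := boolP (p %| a);
  last first.
  by exists 1, a, 0%N; rewrite oner_neq0 scale1r expr0 mulr1.
have q0 : q != 0.
  apply: contraTneq a0 => q0; rewrite q0 mul0r in eqa.
  by move/eqP: eqa; rewrite scale_poly_eq0 (negPf c0) /= negbK.
have szq : (size q < n)%N.
  apply: leq_trans lean; rewrite -(size_scale a c0) eqa.
  rewrite size_mul ?(irredp_neq0 irr_p) // -subn1 -addnBA.
    by rewrite -[X in (X < _)%N]addn0 ltn_add2l subn_gt0 irr_p.1.
  exact: ltnW irr_p.1.
have [c' [r [k [c'0 eqq npr]]]] := IHn q q0 szq.
exists (c' * c), r, k.+1; split=> //; first by rewrite mulf_neq0.
by rewrite -scalerA eqa scalerAl eqq exprSr mulrA.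
Qed.

Lemma factor_orderP p a : irreducible_poly p -> a != 0 ->
  exists c q, [/\ c != 0, c *: a = q * p ^+ factor_order p a & ~~ (p %| q)].
Proof.
move=> irr_p a0.
have [c [q [n [c0 eqa npq]]]] := factor_order_exists irr_p a0.
by exists c, q; rewrite (factor_order_eq irr_p a0 c0 eqa npq).
Qed.

Lemma factor_orderM p a b : irreducible_poly p -> a != 0 -> b != 0 ->
  factor_order p (a * b) = (factor_order p a + factor_order p b)%N.
Proof.
move=> irr_p a0 b0.
have [c [q [c0 eqa npq]]] := factor_orderP irr_p a0.
have [d [r [d0 eqb npr]]] := factor_orderP irr_p b0.
apply: (@factor_order_eq p (a * b) (q * r) (c * d)) => //.
- by rewrite mulf_neq0.
- by rewrite mulf_neq0.
- by rewrite exprD mulrACA -eqa -eqb -scalerA scalerAr -scalerAl.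
- by rewrite Gauss_dvdpr // irreducible_coprime.
Qed.

Lemma factor_orderZ p c a : c != 0 ->
  factor_order p (c *: a) = factor_order p a.
Proof.
move=> c0; rewrite /factor_order size_scale //.
by apply: eq_bigl => n; rewrite (eqp_dvdr _ (eqp_scale a c0)).
Qed.
End FactorOrder.

(** [v] is additive on products of nonzero elements. *)
Definition additive_val (M : idomainType) (v : M -> nat) :=
  {in [pred a | a != 0] &, {morph v : a b / a * b >-> (a + b)%N}}.

(** For each nonzero [Psi], finitely many additive functions determine the
    divisors of the powers of [Psi] up to a factor taken in a finite set [Z]
    which does not depend on [Psi]. *)
Definition finite_val_rank (M : idomainType) :=
  exists Z : seq M, forall Psi : M, Psi != 0 ->
  exists r (v : 'I_r -> M -> nat), (forall i, additive_val (v i)) /\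
  forall m a b a' b', a * a' = Psi ^+ m -> b * b' = Psi ^+ m ->
    (forall i, v i a = v i b) -> exists2 z, z \in Z & a = z * b.

(** Over the fraction field, the orders at the irreducible factors of [Psi]
    determine a divisor of a power of [Psi] up to a constant. *)
Lemma factor_val_poly (R : idomainType) (Psi : {poly R}) : Psi != 0 ->
  exists r (v : 'I_r -> {poly R} -> nat),
  [/\ forall i, additive_val (v i),
      forall i c a, c != 0 -> v i (c *: a) = v i a
    & forall m a b, a %| Psi ^+ m -> b %| Psi ^+ m ->
    (forall i, v i a = v i b) -> a %= b].
Proof.
have [n] := ubnP (size Psi); elim: n Psi => // n IHn Psi /ltnSE-len Psi0.
have [Psi_gt1|Psi_le1] := ltnP 1 (size Psi); last first.
  exists 0, (fun _ _ => 0%N); split=> [[]//|//|m a b aP bP _].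
  have P1 : Psi %= 1.
    by rewrite -size_poly_eq1 eqn_leq Psi_le1 size_poly_gt0.
  have {}P1 : Psi ^+ m %= 1 by rewrite -(expr1n _ m) eqp_exp.
  rewrite (eqp_trans (dvdp_eqp1 aP P1)) // eqp_sym.
  exact: dvdp_eqp1 bP P1.
have [p irr_p /Pdiv.WeakIdomain.dvdpP[[c q] /= c0 eqPsi]]
  := irreducible_factor_exists Psi_gt1.
have p0 := irredp_neq0 irr_p.
have q0 : q != 0.
  apply: contraTneq Psi0 => q0; rewrite q0 mul0r in eqPsi.
  by move/eqP: eqPsi; rewrite scale_poly_eq0 (negPf c0) /= negbK.
have szq : (size q < n)%N.
  apply: leq_trans len; rewrite -(size_scale Psi c0) eqPsi.
  rewrite size_mul // -subn1 -addnBA.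
    by rewrite -[X in (X < _)%N]addn0 ltn_add2l subn_gt0 irr_p.1.
  exact: ltnW irr_p.1.
have [r [v [vM vZ vP]]] := IHn q szq q0.
exists r.+1, (fun i => oapp v (factor_order p) (unlift ord0 i)); split.
- move=> i; case: unliftP => [j|] _ /=; first exact: vM.
  by move=> a b a0 b0; exact: factor_orderM.
- move=> i d a d0; case: unliftP => [j|] _ /=; first exact: vZ.
  exact: factor_orderZ.
move=> m a b aP bP eqv.
have nz x : x %| Psi ^+ m -> x != 0.
  by apply: contraTneq => ->; rewrite dvd0p expf_neq0.
have redq x : x %| Psi ^+ m -> exists d y, [/\ d != 0,
    d *: x = y * p ^+ factor_order p x & y %| q ^+ m].
  move=> xP; have [d [y [d0 eqx npy]]] := factor_orderP irr_p (nz _ xP).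
  exists d, y; split=> //.
  have: y %| q ^+ m * p ^+ m.
    rewrite -exprMn -eqPsi exprZn (eqp_dvdr _ (eqp_scale _ _)) ?expf_neq0 //.
    apply: dvdp_trans xP; rewrite -(eqp_dvdr _ (eqp_scale x d0)) eqx.
    exact: dvdp_mulr.
  rewrite Gauss_dvdpl // coprimep_expr // coprimep_sym.
  exact: irreducible_coprime.
(* Strip [p] from [a] and [b]; the cofactors divide [q ^+ m]. *)
have [d [y [d0 eqa yq]]] := redq a aP.
have [d' [y' [d'0 eqb y'q]]] := redq b bP.
have eq0 : factor_order p a = factor_order p b.
  by have := eqv ord0; rewrite unlift_none.
have nzy e x w : e != 0 -> x %| Psi ^+ m ->
    e *: x = w * p ^+ factor_order p x -> w != 0.
  move=> e0 xP eqx; have := nz _ xP; apply: contraNneq => w0.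
  by move/eqP: eqx; rewrite w0 mul0r scale_poly_eq0 (negPf e0).
have y0 := nzy _ _ _ d0 aP eqa.
have y'0 := nzy _ _ _ d'0 bP eqb.
have pk0 k : p ^+ k != 0 by rewrite expf_neq0.
suff eqy : y %= y'.
  rewrite -(eqp_ltrans (eqp_scale a d0)) -(eqp_rtrans (eqp_scale b d'0)).
  by rewrite eqa eqb eq0 eqp_mulr.
apply: (vP m) => // i.
have := eqv (lift ord0 i); rewrite liftK /= -(vZ i d a) // -(vZ i d' b) //.
by rewrite eqa eqb eq0 !vM ?inE ?expf_neq0 // => /addIn.
Qed.

(** A divisor of a power of [Psi] is determined up to a constant of the fraction
    field by [factor_val_poly]; its leading coefficient, which divides a power
    of the leading coefficient of [Psi], then fixes this constant up to [Z]. *)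
Lemma finite_val_rank_poly (R : idomainType) :
  finite_val_rank R -> finite_val_rank {poly R}.
Proof.
move=> [Z ZP]; exists [seq z%:P | z <- Z] => Psi Psi0.
have [r [v [vM vZ vP]]] := factor_val_poly Psi0.
have lP0 : lead_coef Psi != 0 by rewrite lead_coef_eq0.
have [r' [v' [v'M v'P]]] := ZP _ lP0.
exists (r + r')%N, (fun i => match fintype.split i with
  inl j => v j | inr j => fun a => v' j (lead_coef a) end); split.
  move=> i; case: (fintype.split i) => j; first exact: vM.
  by move=> a b a0 b0; rewrite lead_coefM v'M // inE lead_coef_eq0.
move=> m a b a' b' aa' bb' eqv.
have b0 : b != 0.
  have: b * b' != 0 by rewrite bb' expf_neq0.
  by rewrite mulf_eq0 negb_or => /andP[].
have lead_dvd x y : x * y = Psi ^+ m ->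
    lead_coef x * lead_coef y = lead_coef Psi ^+ m.
  by move=> xy; rewrite -lead_coefM xy lead_coef_exp.
have [|z zZ lab] := v'P m _ _ _ _ (lead_dvd _ _ aa') (lead_dvd _ _ bb').
  by move=> i; have := eqv (unsplit (inr i)); rewrite unsplitK.
have /eqpP[[c d] /= /andP[c0 d0] eqab] : a %= b.
  apply: (vP m).
  - by rewrite -aa' dvdp_mulr.
  - by rewrite -bb' dvdp_mulr.
  - by move=> i; have := eqv (unsplit (inl i)); rewrite unsplitK.
exists z%:P; first exact: map_f.
have := congr1 lead_coef eqab; rewrite !lead_coefZ lab mulrA => eqd.
have {}eqd : c * z = d.
  by apply: (mulIf _ eqd); rewrite lead_coef_eq0.
have cP0 : c%:P != 0 :> {poly R} by rewrite polyC_eq0.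
by apply: (mulfI cP0); rewrite !mul_polyC eqab -eqd scalerA.
Qed.

Lemma finite_val_rank_finField (F : finFieldType) : finite_val_rank F.
Proof.
exists (enum F) => Psi Psi0; exists 0, (fun _ _ => 0%N); split=> [[]//|].
move=> m a b a' b' _ bb' _; exists (a / b); first by rewrite mem_enum.
rewrite divfK //; have: b * b' != 0 by rewrite bb' expf_neq0.
by rewrite mulf_eq0 negb_or => /andP[].
Qed.

(** * Groups with finitely many homomorphisms to the integers *)

Section HomsToZ.
Variable G : groupType.
Implicit Types (g h : G) (A : G -> Prop).

(** Subgroups as propositional predicates. *)
Definition is_subgroup A :=
  [/\ A 1%g, forall g h, A g -> A h -> A (g * h)%g & forall g, A g -> A g^-1%g].

(** [A] is contained in the subgroup generated by some finite sequence (whose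
    entries need not lie in [A]). *)
Definition generated_by_seq A := exists s : seq G, forall K : {pred G},
  group_closed K -> {subset s <= K} -> forall g, A g -> g \in K.

(** If the kernel of [w] on [A] is finitely generated, then adding an element of
    [A] of least positive [w], if any, generates [A], by Euclidean division. *)
Lemma generated_by_seq_ker A (w : G -> int) : is_subgroup A ->
  (forall g h, w (g * h)%g = w g + w h) ->
  generated_by_seq (fun g => A g /\ w g = 0) -> generated_by_seq A.
Proof.
move=> [A1 AM AV] wM [s sP].
have w1 : w 1%g = 0 by apply: (addrI (w 1%g)); rewrite -wM mulg1 addr0.
have wV g : w g^-1%g = - w g by apply/eqP; rewrite -addr_eq0 -wM mulVg w1.
have wX g n : w (g ^+ n)%g = w g *+ n.
  by elim: n => [|n IHn]; rewrite ?expg0 // expgS wM IHn mulrS.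
have AX g n : A g -> A (g ^+ n)%g.
  by move=> Ag; elim: n => [|n IHn]; rewrite ?expg0 // expgS; exact: AM.
have pos_or g : A g -> w g = 0 \/ exists h n, [/\ A h, w h = (n.+1)%:Z &
    g = h \/ g = h^-1%g].
  move=> Ag; case wg: (w g) => [[|n]|n]; first by left.
    by right; exists g, n; split=> //; left.
  right; exists g^-1%g, n; split; first exact: AV.
    by rewrite wV wg NegzE opprK.
  by right; rewrite invgK.
pose P n := `[< exists2 h, A h & w h = (n.+1)%:Z >].
have [[n Pn]|noP] := pselect (exists n, P n); last first.
  exists s => K clK sK g Ag; apply: (sP K clK sK); split=> //.
  have [//|[h [n [Ah wh _]]]] := pos_or g Ag.
  by case: noP; exists n; apply/asboolP; exists h.
have exP : exists n, P n by exists n.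
case: (ex_minnP exP) => N /asboolP[h Ah wh] minN.
exists (h :: s) => K clK sK.
have hK : h \in K by apply: sK; rewrite mem_head.
have KM := group_closedM clK; have KV := group_closedV clK.
have KX k : (h ^+ k)%g \in K.
  by elim: k => [|k IHk]; rewrite ?expg0 ?clK.1 // expgS KM.
have kerK g : A g -> w g = 0 -> g \in K.
  by move=> Ag wg; apply: (sP K clK) => // x xs; apply: sK; rewrite inE xs orbT.
have posK g k : A g -> w g = k.+1%:Z -> g \in K.
  move=> Ag wg; pose q := (k.+1 %/ N.+1)%N.
  have wgq : w (g * (h ^+ q)^-1)%g = (k.+1 %% N.+1)%N.
    rewrite wM wV wX wh wg; apply/eqP; rewrite subr_eq addrC.
    by rewrite -mulr_natr natz -PoszM -PoszD mulnC -divn_eq.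
  have Agq : A (g * (h ^+ q)^-1)%g by apply: AM => //; apply: AV; exact: AX.
  rewrite -(mulgVK (h ^+ q)%g g); apply: KM => //; apply: kerK => //.
  rewrite wgq; case E: (_ %% _)%N => [//|r].
  have Pr : P r.
    by apply/asboolP; exists (g * (h ^+ q)^-1)%g => //; rewrite wgq E.
  have := ltn_pmod k.+1 (ltn0Sn N); rewrite E ltnS => ltrN.
  by have := leq_trans ltrN (minN r Pr); rewrite ltnn.
move=> g Ag; have [wg|[h' [k [Ah' wh' []]]]] := pos_or g Ag.
- exact: kerK.
- by move=> ->; exact: posK wh'.
- by move=> ->; apply: KV; exact: posK wh'.
Qed.

Lemma finitely_generated_of_homs r (w : 'I_r -> G -> int) :
  (forall i g h, w i (g * h)%g = w i g + w i h) ->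
  (exists s : seq G, forall g, (forall i, w i g = 0) -> g \in s) ->
  finitely_generated_group G.
Proof.
move=> wM [s sP].
suff /(_ (fun=> True) r (leqnn r))[|g _ wg|t tP] : forall A n,
  (n <= r)%N -> is_subgroup A ->
  (forall g, A g -> (forall i : 'I_r, (i < n)%N -> w i g = 0) -> g \in s) ->
  generated_by_seq A.
- by split.
- by apply: sP => i; exact: wg.
- by exists t => K clK tK g; exact: (tP K clK tK).
move=> A n; elim: n A => [|n IHn] A ltnr AG As.
  by exists s => K clK sK g Ag; apply/sK/As.
apply: (@generated_by_seq_ker A (w (Ordinal ltnr))) => //.
apply: IHn (ltnW ltnr) _ _.
  case: AG => A1 AM AV; have wi := wM (Ordinal ltnr).
  have w1 : w (Ordinal ltnr) 1%g = 0.
    by apply: (addrI (w (Ordinal ltnr) 1%g)); rewrite -wi mulg1 addr0.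
  split=> //.
  - by move=> g h [Ag wg] [Ah wh]; split; [exact: AM|rewrite wi wg wh].
  - move=> g [Ag wg]; split; first exact: AV.
    by apply: (addrI (w (Ordinal ltnr) g)); rewrite -wi mulgV w1 wg.
move=> g [Ag wg] wlt; apply: As => // i; rewrite ltnS leq_eqVlt => /predU1P[iE|].
  by have -> : i = Ordinal ltnr by exact: val_inj.
exact: wlt.
Qed.
End HomsToZ.

(** * Laurent polynomial operators and polynomial rings acting on series *)

Section LaurentOperators.
Variables p d : nat.
Notation term := ('F_p * 'rV[int]_d)%type.
Implicit Types (t : seq term) (x y : series p d) (m n : 'rV[int]_d).

(** Multiplication by the Laurent polynomial with the list [t] of terms
    (coefficient, exponent); exponents may be repeated in [t]. *)
Definition lop t x : series p d := fun m => \sum_(c <- t) c.1 * x (m - c.2).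

(** The series [1]. *)
Definition impulse : series p d := fun m => (m == 0)%:R.

Lemma lopD t : {morph lop t : x y / x + y}.
Proof.
move=> x y; apply/funext => m; rewrite /lop -[RHS]big_split /=.
by apply: eq_bigr => c _; rewrite -mulrDr.
Qed.

Lemma lop0 t : lop t 0 = 0.
Proof. by apply: (addrI (lop t 0)); rewrite -lopD !addr0. Qed.

Lemma lop_sum t I (r : seq I) (P : pred I) (F : I -> series p d) :
  lop t (\sum_(i <- r | P i) F i) = \sum_(i <- r | P i) lop t (F i).
Proof. exact: (big_morph (lop t) (lopD t) (lop0 t)). Qed.

Lemma lop_nil x : lop [::] x = 0.
Proof. by apply/funext => m; rewrite /lop big_nil. Qed.

Lemma lop_cat t1 t2 x : lop (t1 ++ t2) x = lop t1 x + lop t2 x.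
Proof. by apply/funext => m; rewrite /lop big_cat. Qed.

Lemma lop_act t n x : lop t (act n x) = act n (lop t x).
Proof.
apply/funext => m; rewrite actE; apply: eq_bigr => c _.
by rewrite actE addrAC.
Qed.

Lemma act_lop1 n x : act n x = lop [:: (1, n)] x.
Proof. by apply/funext => m; rewrite actE /lop big_seq1 mul1r. Qed.

Lemma lopC t1 t2 x : lop t1 (lop t2 x) = lop t2 (lop t1 x).
Proof.
apply/funext => m; rewrite /lop.
under eq_bigr do rewrite big_distrr.
rewrite exchange_big /=; apply: eq_bigr => c _; rewrite big_distrr.
by apply: eq_bigr => c' _; rewrite mulrCA addrAC.
Qed.

Lemma act_act m n x : act m (act n x) = act (m + n) x.
Proof. by apply/funext => k; rewrite !actE opprD addrA. Qed.

Lemma act0 x : act 0 x = x.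
Proof. by apply/funext => k; rewrite actE subr0. Qed.

Lemma actD n x y : act n (x + y) = act n x + act n y.
Proof. by rewrite !act_lop1 lopD. Qed.

Lemma lop_impulse t m : lop t impulse m != 0 -> exists2 c, c \in t & m = c.2.
Proof.
move=> nz; have [[c ct cm]|noc] := pselect (exists2 c, c \in t & m = c.2).
  by exists c.
case/eqP: nz; rewrite /lop big_seq big1 // => c ct.
rewrite /impulse subr_eq0; case: eqP => [mc|]; last by rewrite mulr0.
by case: noc; exists c.
Qed.

(** A polynomial ring in the first [k] variables over ['F_p], together with its
    faithful action on series by Laurent polynomial operators.  Only the
    properties that are used are recorded: [pm_op a] lists terms whose exponents
    vanish from the coordinate [k] on, the monomials in the first [k] variables
    are present, the action of [a] on the series [1] determines [a], and
    [finite_val_rank] holds. *)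
Record poly_model (k : nat) := PolyModel {
  pm_ring :> idomainType;
  pm_op : pm_ring -> seq term;
  pm_opD : forall a b x,
    lop (pm_op (a + b)) x = lop (pm_op a) x + lop (pm_op b) x;
  pm_opM : forall a b x,
    lop (pm_op (a * b)) x = lop (pm_op a) (lop (pm_op b) x);
  pm_op1 : forall x, lop (pm_op 1) x = x;
  pm_supp : forall a c, c \in pm_op a ->
    forall i : 'I_d, (k <= i)%N -> c.2 0 i = 0;
  pm_monom : forall n, (forall i : 'I_d, (i < k)%N -> 0 <= n 0 i) ->
    (forall i : 'I_d, (k <= i)%N -> n 0 i = 0) ->
    exists a, forall x, lop (pm_op a) x = act n x;
  pm_inj : forall a, lop (pm_op a) impulse = 0 -> a = 0;
  pm_val : finite_val_rank pm_ring }.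

Lemma pm_op0 k (M : poly_model k) x : lop (pm_op (0 : M)) x = 0.
Proof.
by apply: (addrI (lop (pm_op (0 : M)) x)); rewrite -pm_opD !addr0.
Qed.

Section PolyStep.
Variables (k : nat) (ltkd : (k < d)%N) (M : poly_model k).
Implicit Types q r : {poly M}.

Let e : 'rV[int]_d := delta_mx 0 (Ordinal ltkd).

(** The terms of a polynomial in one more variable [X]; the exponent of [X] is
    carried by the coordinate [k]. *)
Definition poly_op q : seq term :=
  flatten [seq [seq (c.1, c.2 + e *+ i) | c <- pm_op q`_i]
          | i <- iota 0 (size q)].

Lemma poly_opE q x :
  lop (poly_op q) x = \sum_(i < size q) lop (pm_op q`_i) (act (e *+ i) x).
Proof.
rewrite /poly_op.
rewrite -(big_mkord xpredT (fun i => lop (pm_op q`_i) (act (e *+ i) x))).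
rewrite /index_iota subn0; elim: (iota _ _) => [|i s IHs] /=.
  by rewrite big_nil lop_nil.
rewrite lop_cat big_cons IHs; congr (_ + _); apply/funext => m.
rewrite /lop big_map; apply: eq_bigr => c _ /=.
by rewrite actE opprD addrA.
Qed.

Lemma poly_op_widen q x N : (size q <= N)%N ->
  lop (poly_op q) x = \sum_(i < N) lop (pm_op q`_i) (act (e *+ i) x).
Proof.
move=> leqN; rewrite poly_opE.
rewrite (big_ord_widen N (fun i => lop (pm_op q`_i) (act (e *+ i) x)) leqN).
rewrite [RHS](bigID (fun i : 'I_N => (i < size q)%N)) /=.
rewrite [X in _ + X]big1 ?addr0 //.
by move=> i; rewrite -leqNgt => /leq_sizeP/(_ _ (leqnn _)) ->; rewrite pm_op0.
Qed.

Lemma poly_opD q r x :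
  lop (poly_op (q + r)) x = lop (poly_op q) x + lop (poly_op r) x.
Proof.
pose N := maxn (size q) (size r).
rewrite (@poly_op_widen q _ N) ?leq_maxl // (@poly_op_widen r _ N) ?leq_maxr //.
rewrite (@poly_op_widen (q + r) _ N) ?size_polyD // -big_split /=.
by apply: eq_bigr => i _; rewrite coefD pm_opD.
Qed.

Lemma poly_opZ (c : M) r x :
  lop (poly_op (c%:P * r)) x = lop (pm_op c) (lop (poly_op r) x).
Proof.
rewrite mul_polyC (@poly_op_widen _ _ (size r)) ?size_scale_leq //.
rewrite poly_opE lop_sum; apply: eq_bigr => i _.
by rewrite coefZ pm_opM.
Qed.

Lemma poly_op1 x : lop (poly_op 1) x = x.
Proof.
by rewrite poly_opE size_poly1 big_ord1 mulr0n act0 coef1 pm_op1.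
Qed.

Lemma poly_opX r x : lop (poly_op (r * 'X)) x = lop (poly_op r) (act e x).
Proof.
rewrite (@poly_op_widen _ _ (size r).+1); last first.
  by apply: leq_trans (size_polyMleq _ _) _; rewrite size_polyX addn2.
rewrite big_ord_recl coefMX /= pm_op0 add0r poly_opE.
by apply: eq_bigr => i _; rewrite coefMX /= act_act -mulrSr.
Qed.

Lemma poly_opM q r x :
  lop (poly_op (q * r)) x = lop (poly_op q) (lop (poly_op r) x).
Proof.
have opC c y : lop (poly_op c%:P) y = lop (pm_op c) y.
  by rewrite -[c%:P]mulr1 poly_opZ poly_op1.
elim/poly_ind: q x => [|q c IHq] x.
  have op0 y : lop (poly_op 0) y = 0 by rewrite opC pm_op0.
  by rewrite mul0r !op0.
rewrite mulrDl (mulrAC q 'X r) poly_opD poly_opX IHq poly_opZ.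
by rewrite poly_opD poly_opX opC lop_act.
Qed.

Lemma coordE (i : 'I_d) (j : nat) :
  (e *+ j) 0 i = if (i : nat) == k then j%:Z else 0.
Proof.
rewrite mulmxnE mxE eqxx /= -[i == _]val_eqE /=.
by case: eqP; rewrite ?mul0rn // mulr1n natz.
Qed.

Lemma coord_mulrn (i : nat) : (e *+ i) 0 (Ordinal ltkd) = i%:Z.
Proof. by rewrite coordE eqxx. Qed.

(** The [i]-th coefficient of [q] can be read off the slice of the impulse
    response where the coordinate [k] equals [i]. *)
Lemma poly_op_inj q : lop (poly_op q) impulse = 0 -> q = 0.
Proof.
move=> q0; apply/polyP => i; rewrite coef0; apply: (@pm_inj _ M).
have supp j m : lop (pm_op q`_j) impulse m != 0 -> m 0 (Ordinal ltkd) = 0.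
  by case/lop_impulse => c cq ->; apply: pm_supp cq _ _.
apply/funext => m; case: (eqVneq (m 0 (Ordinal ltkd)) 0) => [mk|]; last first.
  by apply: contraNeq => /supp ->.
have: lop (poly_op q) impulse (m + e *+ i) = 0 by rewrite q0.
rewrite (@poly_op_widen _ _ (maxn i.+1 (size q))) ?leq_maxr //.
have lti : (i < maxn i.+1 (size q))%N by rewrite leq_max leqnn.
rewrite (bigD1 (Ordinal lti)) //= => sum0; apply: etrans sum0.
rewrite lop_act -[LHS]addr0; congr (_ + _).
  by rewrite actE addrK.
rewrite fct_sumE big1 // => j neji; rewrite lop_act actE.
apply/eqP; apply: contraNT neji => /supp.
rewrite mxE [X in _ + X]mxE mxE mk add0r !coord_mulrn => /eqP.
by rewrite subr_eq0 => /eqP[ij]; apply/eqP/val_inj.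
Qed.

Lemma poly_op_supp q c : c \in poly_op q ->
  forall i : 'I_d, (k.+1 <= i)%N -> c.2 0 i = 0.
Proof.
case/flatten_mapP => j _ /mapP[c' c'q ->] i ltki /=.
rewrite mxE (pm_supp c'q) ?(ltnW ltki) // coordE add0r.
by rewrite (gtn_eqF ltki).
Qed.

Lemma poly_op_monom n : (forall i : 'I_d, (i < k.+1)%N -> 0 <= n 0 i) ->
  (forall i : 'I_d, (k.+1 <= i)%N -> n 0 i = 0) ->
  exists q, forall x, lop (poly_op q) x = act n x.
Proof.
move=> n_ge0 n_eq0; pose j := absz (n 0 (Ordinal ltkd)).
have jE : j%:Z = n 0 (Ordinal ltkd) by rewrite gez0_abs // n_ge0.
have [i ltik|i leki|a aP] := @pm_monom _ M (n - e *+ j).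
- by rewrite mxE [X in _ + X]mxE coordE (ltn_eqF ltik) subr0 n_ge0 // ltnW.
- rewrite mxE [X in _ + X]mxE coordE.
  case: (eqVneq (i : nat) k) => [ik|neik].
    have -> : i = Ordinal ltkd by exact: val_inj.
    by rewrite jE subrr.
  by rewrite subr0 n_eq0 // ltn_neqAle eq_sym neik.
exists (a%:P * 'X^j) => x; rewrite poly_opZ aP.
have -> : lop (poly_op 'X^j) x = act (e *+ j) x.
  elim: {jE a aP} j x => [|j IHj] x; first by rewrite expr0 poly_op1 mulr0n act0.
  by rewrite exprSr poly_opX IHj act_act -mulrSr.
by rewrite act_act subrK.
Qed.

Definition poly_model_step : poly_model k.+1 :=
  PolyModel poly_opD poly_opM poly_op1 poly_op_supp poly_op_monom poly_op_inj
    (finite_val_rank_poly (@pm_val _ M)).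
End PolyStep.

(** The constant [a] as a list of terms. *)
Definition term0 (a : 'F_p) : seq term := [:: (a, 0)].

Lemma lop_term0 a x m : lop (term0 a) x m = a * x m.
Proof. by rewrite /lop big_seq1 subr0. Qed.

Lemma poly_model_base : poly_model 0.
Proof.
apply: (@PolyModel 0 'F_p term0).
- by move=> a b x; apply/funext => m; rewrite fctE !lop_term0 mulrDl.
- by move=> a b x; apply/funext => m; rewrite !lop_term0 mulrA.
- by move=> x; apply/funext => m; rewrite lop_term0 mul1r.
- by move=> a c; rewrite inE => /eqP-> i _; rewrite mxE.
- move=> n _ n0; exists 1 => x; apply/funext => m; rewrite lop_term0 mul1r actE.
  by have -> : n = 0 by [apply/rowP => i; rewrite n0 // mxE]; rewrite subr0.
- move=> a /(congr1 (fun x : series p d => x 0)).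
  by rewrite lop_term0 /impulse eqxx mulr1.
- exact: finite_val_rank_finField.
Qed.

Lemma poly_model_exists k : (k <= d)%N -> inhabited (poly_model k).
Proof.
elim: k => [|k IHk] ltkd; first by split; exact: poly_model_base.
by have [M] := IHk (ltnW ltkd); split; exact: (poly_model_step ltkd M).
Qed.
End LaurentOperators.

Arguments impulse : clear implicits.

(** * Division by a Laurent polynomial and the fundamental solution *)

(** The functional reads [m] as the coefficients of a polynomial and evaluates
    it at an integer [B] that is a root of none of the differences. *)
Lemma generic_functional d (K : seq 'rV[int]_d) :
  exists B : int, {in K &, injective (fun m => (rVpoly m).[B])}.
Proof.
pose P : {poly int} := \prod_(k <- K) \prod_(k' <- K | k' != k) rVpoly (k - k').
have P0 : P != 0.
  rewrite prodf_seq_neq0; apply/allP => k _ /=; rewrite prodf_seq_neq0.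
  apply/allP => k' _; apply/implyP => nek.
  apply: contra nek => /eqP/(congr1 (poly_rV (d := d))).
  by rewrite rVpolyK linear0 => /eqP; rewrite subr_eq0 eq_sym.
have [B PB] : exists B, ~~ root P B.
  apply: contrapT => noB.
  pose rs := [seq i%:Z | i <- iota 0 (size P)].
  have := @max_poly_roots _ P rs P0.
  rewrite size_map size_iota ltnn => H; apply: notF; apply: H.
    apply/allP => B _; apply: contrapT => /negP nB; apply: noB; by exists B.
  by rewrite map_inj_uniq ?iota_uniq // => i j [].
exists B => k k' kK k'K eqB; apply: contraNeq PB => nek.
rewrite /P (big_rem k) //= rootM (big_rem k') //= eq_sym nek rootM.
by rewrite /root linearB /= hornerD hornerN eqB subrr eqxx.
Qed.

Lemma seq_argmin (T : eqType) (f : T -> int) (K : seq T) : (0 < size K)%N ->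
  exists2 k0, k0 \in K & forall k, k \in K -> f k0 <= f k.
Proof.
elim: K => // k K IHK _; case: K => [|k' K] in IHK *.
  by exists k => [|x]; rewrite inE // => /eqP->.
have [//|k0 k0K k0P] := IHK.
have [le|lt] := leP (f k) (f k0).
  exists k; first exact: mem_head.
  by move=> x; rewrite inE => /predU1P[->//|/k0P]; exact: le_trans.
exists k0; first by rewrite inE k0K orbT.
by move=> x; rewrite inE => /predU1P[->|/k0P//]; exact: ltW.
Qed.

Section Solve.
Variables (p d : nat) (K : seq 'rV[int]_d) (a : 'rV[int]_d -> 'F_p).
Hypotheses (uK : uniq K) (K0 : (0 < size K)%N).
Hypothesis a0 : forall k, k \in K -> a k != 0.
Implicit Types (x y : series p d) (m n : 'rV[int]_d).

(** The terms of the Laurent polynomial with support [K] and coefficients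
    [a]. *)
Definition seq_op := [seq (a k, k) | k <- K].

Lemma seq_opE x m : lop seq_op x m = \sum_(k <- K) a k * x (m - k).
Proof. by rewrite /lop big_map. Qed.

(** [x] vanishes where [l] is small. *)
Definition bounded_below (l : 'rV[int]_d -> int) x :=
  exists L : int, forall m, l m < L -> x m = 0.

Section Division.
Variable (l : 'rV[int]_d -> int) (k0 : 'rV[int]_d).
Hypotheses (lB : forall m n, l (m - n) = l m - l n) (k0K : k0 \in K).
Hypothesis k0P : forall k, k \in K -> k != k0 -> l k0 < l k.

(** [n]-th approximation of the quotient of [y] by the Laurent polynomial whose
    term of least [l] has exponent [k0]: solving for this term expresses a
    coefficient of the quotient by coefficients where [l] is smaller. *)
Fixpoint quotient y (n : nat) m : 'F_p := if n is n'.+1 then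
  (a k0)^-1 * (y (m + k0)
    - \sum_(k <- K | k != k0) a k * quotient y n' (m + k0 - k))
  else 0.

Lemma lop_surj_bounded y : bounded_below l y ->
  exists2 x, bounded_below l x & lop seq_op x = y.
Proof.
move=> [L yL]; pose L' := L - l k0.
have lD m n : l (m + n) = l m + l n.
  have l0 : l 0 = 0 by rewrite -(subrr (0 : 'rV_d)) lB subrr.
  have lN : l (- n) = - l n by rewrite -[- n]add0r lB l0 add0r.
  by have := lB m (- n); rewrite lN !opprK.
have stab1 (n : nat) m : l m < L' + n%:Z -> quotient y n.+1 m = quotient y n m.
  elim: n m => [|n IHn] m lm.
    rewrite /= yL ?lD; last by rewrite /L' in lm; lia.
    by rewrite big1 ?subr0 ?mulr0 // => k _; rewrite mulr0.
  rewrite [LHS]/= [RHS]/=; congr (_ * (_ - _)).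
  rewrite big_seq_cond [RHS]big_seq_cond; apply: eq_bigr => k /andP[kK nek].
  by rewrite -IHn // lB lD; have := k0P kK nek; lia.
have stab (n n' : nat) m : (n <= n')%N -> l m < L' + n%:Z ->
    quotient y n' m = quotient y n m.
  move=> /subnK <-; elim: (n' - n)%N => // j IHj lm.
  by rewrite addSn stab1 ?IHj //; lia.
pose N m := (absz (l m - L')).+1.
pose x : series p d := fun m => quotient y (N m) m.
have ltN m : l m < L' + (N m)%:Z by rewrite /N; lia.
have xE (n : nat) m : l m < L' + n%:Z -> x m = quotient y n m.
  move=> lm; rewrite /x; have [le|/ltnW le] := leqP n (N m); first exact: stab.
  by rewrite (stab _ _ _ le).
exists x; first by exists L' => m lm; rewrite (xE 0%N) // addr0.
apply/funext => m; rewrite seq_opE (bigD1_seq k0) //=.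
pose n := N (m - k0).
have -> : x (m - k0) = quotient y n.+1 (m - k0).
  by apply: xE; have := ltN (m - k0); rewrite -/n; lia.
rewrite /= subrK mulVKf ?a0 // big_seq_cond [X in _ + X]big_seq_cond.
rewrite -[RHS](subrK (\sum_(k <- K | (k \in K) && (k != k0)) a k * x (m - k))).
congr (_ - _ + _); apply: eq_bigr => k /andP[kK nek].
rewrite (@xE n) //; have := ltN (m - k0); rewrite -/n !lB.
by have := k0P kK nek; lia.
Qed.
End Division.

(** A two-sided orbit of the impulse under multiplication by [seq_op]: powers on
    one side, iterated quotients on the other. *)
Lemma impulse_orbit : exists D : int -> series p d,
  D 0 = impulse p d /\ forall i, lop seq_op (D (i + 1)) = D i.
Proof.
have [B injB] := generic_functional K.
pose l (m : 'rV[int]_d) := (rVpoly m).[B].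
have lB m n : l (m - n) = l m - l n by rewrite /l linearB /= hornerD hornerN.
(* As [l] is injective on [K], the term of least [l] is unique. *)
have [k0 k0K k0P] := seq_argmin l K0.
have k0lt k : k \in K -> k != k0 -> l k0 < l k.
  move=> kK nek; rewrite lt_neqAle k0P // andbT.
  by apply: contra nek => /eqP/injB->.
have solve y : {x | bounded_below l y -> bounded_below l x /\ lop seq_op x = y}.
  apply: cid; have [yb|nyb] := pselect (bounded_below l y); last by exists y.
  by have [x] := lop_surj_bounded lB k0K k0lt yb; exists x.
pose inv y := sval (solve y).
pose D (i : int) := match i with
  Posz n => iter n inv (impulse p d)
  | Negz n => iter n.+1 (lop seq_op) (impulse p d) end.
have ib : bounded_below l (impulse p d).
  exists 0 => m lm; rewrite /impulse; case: eqP => // m0; move: lm.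
  by rewrite m0 -(subrr (0 : 'rV_d)) lB subrr ltxx.
have Db (n : nat) : bounded_below l (iter n inv (impulse p d)).
  by elim: n => //= n IHn; case: (svalP (solve _) IHn).
exists D; split=> // -[n|[|n]].
- rewrite -PoszD addn1 /=.
  by case: (svalP (solve _) (Db n)).
- by [].
- have -> : Negz n.+1 + 1 = Negz n by lia.
  by [].
Qed.

Variables (h : 'rV[int]_d -> int) (e : 'rV[int]_d).
Hypothesis hB : forall m n, h (m - n) = h m - h n.
Hypotheses (he : h e = 1) (hK : forall k, k \in K -> h k = 0).

(** [h] is the row index and [e] leads from one row to the next.  Row [i] of [G]
    is the [i]-th entry of the orbit of the impulse, moved along [i] times
    [e]. *)
Lemma fundamental_solution : exists2 G : series p d,
  act e G = lop seq_op G & forall m, h m = 0 -> G m = (m == 0)%:R.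
Proof.
have [D [D0 DS]] := impulse_orbit.
exists (fun m => D (h m) (m - e *~ h m)); last first.
  by move=> m ->; rewrite D0 mulr0z subr0.
apply/funext => m; rewrite actE hB he.
rewrite mulrzBr mulr1z opprB addrA subrK.
rewrite -(DS (h m - 1)) subrK seq_opE big_seq [RHS]seq_opE [RHS]big_seq.
apply: eq_bigr => k kK; rewrite hB (hK kK) subr0.
by rewrite addrAC.
Qed.
End Solve.

(** * Continuity and finite windows *)

Section Cylinders.
Local Open Scope classical_set_scope.
Variables p d : nat.

(** The filter generated by the cylinder sets around [x]. *)
Definition cylinders (x : series p d) : set_system (series p d) :=
  [set A | exists W : seq 'rV[int]_d,
     forall z : series p d, (forall m, m \in W -> z m = x m) -> A z].

Instance cylinders_filter x : Filter (cylinders x).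
Proof.
split.
- by exists [::].
- move=> A B [W WA] [W' W'B]; exists (W ++ W') => z zx; split.
    by apply: WA => m mW; apply: zx; rewrite mem_cat mW.
  by apply: W'B => m mW; apply: zx; rewrite mem_cat mW orbT.
- by move=> A B AB [W WA]; exists W => z /WA /AB.
Qed.

(** A neighborhood for the product topology contains a cylinder set. *)
Lemma nbhs_cylinder (x : series p d) (A : set (series p d)) :
  nbhs x A -> cylinders x A.
Proof.
suff: cylinders x --> (x : {ptws 'rV[int]_d -> discrete_topology 'F_p}).
  by move=> /[apply].
apply/cvg_sup => m U; rewrite nbhsE => -[B [[C oC CB] Bx] BU].
exists [:: m] => z zx /=.
apply: BU; move: Bx; rewrite -CB /= => Cx.
by rewrite (zx m) ?mem_head.
Qed.

Lemma nbhs_coord (x : series p d) (m : 'rV[int]_d) :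
  nbhs x [set z : series p d | z m = x m].
Proof.
apply: (@proj_continuous _ (fun=> discrete_topology 'F_p) m x [set x m]).
by apply: open_nbhs_nbhs; split=> //; exact: discrete_open.
Qed.

Lemma continuous_finite_window (P : laurent p d) (f : perp P -> perp P) :
  continuous f -> forall x, exists W : seq 'rV[int]_d, forall z : perp P,
    (forall m, m \in W -> \val z m = \val x m) -> \val (f z) 0 = \val (f x) 0.
Proof.
move=> cf x.
have nfx : nbhs (f x) [set y : perp P | \val y 0 = \val (f x) 0].
  have := @initial_continuous _ (series p d) (@set_val _ (perp P)) (f x) _
    (nbhs_coord _ _).
  exact.
have [B [[C oC CB] Bx] Bsub] := cf x _ nfx.
have [|W WC] := @nbhs_cylinder (\val x) C.
  by apply: open_nbhs_nbhs; split=> //; rewrite -CB in Bx.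
by exists W => z zx; apply: Bsub; rewrite -CB; exact: WC.
Qed.
End Cylinders.

(** * Polynomials in all variables but the last; the Frobenius identity *)

Section ModelFacts.
Variables (p k : nat) (M : poly_model p k.+1 k).
Implicit Types (x y z : series p k.+1) (m n s : 'rV[int]_k.+1).

(** The last exponent; the rows are the sets of constant height. *)
Definition height m : int := m 0 ord_max.

Lemma heightB m n : height (m - n) = height m - height n.
Proof. by rewrite /height !mxE. Qed.

Lemma heightD m n : height (m + n) = height m + height n.
Proof. by rewrite /height !mxE. Qed.

Lemma pm_op_natr (c : nat) x : lop (pm_op (c%:R : M)) x = x *+ c.
Proof.
elim: c => [|c IHc]; first by rewrite pm_op0.
by rewrite mulrS pm_opD pm_op1 IHc -mulrS.
Qed.

Lemma pm_op_sum (I : Type) (r : seq I) (P : pred I) (f : I -> M) x :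
  lop (pm_op (\sum_(i <- r | P i) f i)) x
  = \sum_(i <- r | P i) lop (pm_op (f i)) x.
Proof.
apply: (big_morph (fun a : M => lop (pm_op a) x)) => [a b|].
  exact: pm_opD.
exact: pm_op0.
Qed.

Lemma series_mulrn x (j : nat) m : (x *+ j) m = x m *+ j.
Proof. by elim: j => // j IHj; rewrite !mulrS -IHj. Qed.

Lemma pm_pchar (Hp : prime p) : p \in [pchar M].
Proof.
rewrite inE Hp /=; apply/eqP/pm_inj; rewrite pm_op_natr.
by apply/funext => m; rewrite series_mulrn mulrn_pchar // pchar_Fp.
Qed.

(** Pointwise multiplication by a scalar. *)
Definition scale (c : 'F_p) x : series p k.+1 := lop (term0 k.+1 c) x.

Lemma scaleE c x m : scale c x m = c * x m.
Proof. exact: lop_term0. Qed.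

Lemma scale_natr (c : 'F_p) x : scale c x = x *+ (c : nat).
Proof.
apply/funext => m; rewrite scaleE -{1}(natr_Zp c) mulr_natl.
by rewrite series_mulrn.
Qed.

Lemma pm_op_scale (c : 'F_p) x : lop (pm_op ((c : nat)%:R : M)) x = scale c x.
Proof. by rewrite pm_op_natr scale_natr. Qed.

Lemma frobenius_natr (Hp : prime p) (c n : nat) : (c%:R : M) ^+ (p ^ n) = c%:R.
Proof.
elim: n => [|n IHn]; first by rewrite expn0 expr1.
rewrite expnSr exprM IHn -(pFrobenius_autE (pm_pchar Hp)).
exact: pFrobenius_aut_nat.
Qed.

Lemma frobenius_sum (Hp : prime p) (I : Type) (r : seq I) (f : I -> M) (n : nat) :
  (\sum_(i <- r) f i) ^+ (p ^ n) = \sum_(i <- r) f i ^+ (p ^ n).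
Proof.
apply: (big_morph (fun a : M => a ^+ (p ^ n))) => [a b|].
  by rewrite exprDn_pchar // pnatX pnatE ?Hp // pm_pchar.
by rewrite expr0n expn_eq0 -leqn0 leqNgt prime_gt0.
Qed.

(** The exponent of the product of all variables but the last. *)
Definition ones : 'rV[int]_k.+1 := \row_i (i < k)%N%:R.

(** A Laurent monomial in all variables but the last becomes a polynomial once
    multiplied by a large power of the product of these variables. *)
Lemma monom_shift n : height n = 0 -> exists N0, forall N, (N0 <= N)%N ->
  exists a : M, forall x, lop (pm_op a) x = act (n + ones *+ N) x.
Proof.
move=> hn; exists (\sum_i absz (n 0%R i))%N => N leN; apply: pm_monom.
  move=> i ltik; rewrite mxE mulmxnE mxE ltik mulr1n natz.
  suff : (absz (n 0%R i) <= N)%N.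
    by move: (n 0 i) => z; lia.
  by apply: leq_trans leN; rewrite (bigD1 i) //= leq_addr.
move=> i leki; rewrite mxE mulmxnE mxE ltnNge leki mul0rn addr0.
have -> // : i = ord_max.
by apply/val_inj/eqP; rewrite eqn_leq leki -ltnS /= ltn_ord.
Qed.

Variables (K : seq 'rV[int]_k.+1) (c : 'rV[int]_k.+1 -> 'F_p).
Hypothesis hK : forall n, n \in K -> height n = 0.
Variable e : 'rV[int]_k.+1.

Lemma lop_seq_opE x : lop (seq_op K c) x = \sum_(n <- K) scale (c n) (act n x).
Proof.
apply/funext => m; rewrite seq_opE fct_sumE; apply: eq_bigr => n _.
by rewrite scaleE actE.
Qed.

Lemma act_sum n (I : Type) (r : seq I) (f : I -> series p k.+1) :
  act n (\sum_(i <- r) f i) = \sum_(i <- r) act n (f i).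
Proof.
by rewrite act_lop1 lop_sum; apply: eq_bigr => i _; rewrite -act_lop1.
Qed.

Lemma act_scale n b x : act n (scale b x) = scale b (act n x).
Proof. by rewrite /scale lop_act. Qed.

Lemma seq_op_shift : exists N0, forall N, (N0 <= N)%N ->
  exists f : 'rV[int]_k.+1 -> M, forall n, n \in K ->
  forall x, lop (pm_op (f n)) x = act (n + ones *+ N) x.
Proof.
have [N0 N0P] : exists N0, forall n, n \in K -> forall N, (N0 <= N)%N ->
    exists a : M, forall x, lop (pm_op a) x = act (n + ones *+ N) x.
  elim: K hK => [|n s IHs] hs; first by exists 0%N.
  have [|N1 N1P] := IHs; first by move=> m ms; apply: hs; rewrite inE ms orbT.
  have [N2 N2P] := monom_shift (hs n (mem_head _ _)).
  exists (maxn N1 N2) => m; rewrite inE => /predU1P[->|ms] N.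
    by rewrite geq_max => /andP[_ /N2P].
  by rewrite geq_max => /andP[/(N1P _ ms)].
exists N0 => N leN.
have aex n :
  {a : M | n \in K -> forall x, lop (pm_op a) x = act (n + ones *+ N) x}.
  apply: cid; case: (boolP (n \in K)) => [nK|_]; last by exists 0.
  by have [a aP] := N0P n nK N leN; exists a.
by exists (fun n => sval (aex n)) => n nK; apply: (svalP (aex n)).
Qed.

Lemma pm_op_shifted_sum (f : 'rV[int]_k.+1 -> M) w y :
  (forall n, n \in K -> forall x, lop (pm_op (f n)) x = act (n + w) x) ->
  lop (pm_op (\sum_(n <- K) (c n : nat)%:R * f n)) y
  = act w (lop (seq_op K c) y).
Proof.
move=> fP; rewrite pm_op_sum lop_seq_opE act_sum big_seq [RHS]big_seq.
apply: eq_bigr => n nK; rewrite pm_opM pm_op_scale fP //.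
by rewrite act_scale act_act addrC.
Qed.

Lemma lop_pm_exp (a : M) n x (j : nat) :
  (forall i, lop (pm_op a) (act (n *+ i) x) = act n (act (n *+ i) x)) ->
  lop (pm_op (a ^+ j)) x = act (n *+ j) x.
Proof.
move=> aP; elim: j => [|j IHj]; first by rewrite expr0 pm_op1 mulr0n act0.
by rewrite exprS pm_opM IHj aP act_act -mulrS.
Qed.

Lemma act_inj n : injective (@act p k.+1 n).
Proof.
by move=> x y /(congr1 (act (- n))); rewrite !act_act addNr !act0.
Qed.

(** If [X^e - sum_n c_n X^n] kills [x], then so does
    [X^(q e) - sum_n c_n X^(q n)] for [q = p^i].  The binomial theorem in
    characteristic [p] is applied in the polynomial ring [M], where
    [sum_n c_n X^n] lies after multiplication by a monomial. *)
Lemma frobenius_identity (Hp : prime p) x i : act e x = lop (seq_op K c) x ->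
  act (e *+ (p ^ i)) x = \sum_(n <- K) scale (c n) (act (n *+ (p ^ i)) x).
Proof.
move=> xP; have [N /(_ N (leqnn N))[f fP]] := seq_op_shift.
pose a : M := \sum_(n <- K) (c n : nat)%:R * f n.
have aE y := pm_op_shifted_sum y fP.
have eqa : lop (pm_op (a ^+ (p ^ i))) x = act ((ones *+ N + e) *+ (p ^ i)) x.
  apply: lop_pm_exp => j.
  rewrite aE lop_act -xP !act_act; congr (act _ x).
  by rewrite ?addrA [RHS]addrAC.
apply: (@act_inj (ones *+ N *+ (p ^ i))).
rewrite act_act -mulrnDl -eqa /a (frobenius_sum Hp) pm_op_sum act_sum.
rewrite big_seq [RHS]big_seq; apply: eq_bigr => n nK.
rewrite exprMn pm_opM (frobenius_natr Hp) pm_op_scale act_scale; congr (scale _ _).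
rewrite act_act -mulrnDl addrC; apply: lop_pm_exp => j; exact: fP.
Qed.

End ModelFacts.

(** * Rigidity of equivariant maps *)

Section Rigidity.
Variables (p k : nat).
Variables (K : seq 'rV[int]_k.+1) (c : 'rV[int]_k.+1 -> 'F_p).
Hypothesis hK : forall n, n \in K -> height n = 0.
Variable e : 'rV[int]_k.+1.
Hypothesis he : height e = 1.
Implicit Types (x y z : series p k.+1) (m n s : 'rV[int]_k.+1).

(** The series killed by [X^e - sum_(n in K) c_n X^n]. *)
Definition solution x := act e x = lop (seq_op K c) x.

Lemma solution_lop t x : solution x -> solution (lop t x).
Proof. by rewrite /solution => xP; rewrite -lop_act xP lopC. Qed.

Lemma solution_act n x : solution x -> solution (act n x).
Proof. by rewrite act_lop1; exact: solution_lop. Qed.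

Lemma solutionD x y : solution x -> solution y -> solution (x + y).
Proof. by rewrite /solution actD lopD => -> ->. Qed.

Lemma solution0 : solution 0.
Proof. by rewrite /solution act_lop1 !lop0. Qed.

Lemma height_mulrn n j : height n = 0 -> height (n *+ j) = 0.
Proof.
move=> hn; elim: j => [|j IHj]; first by rewrite mulr0n /height mxE.
by rewrite mulrS heightD hn IHj.
Qed.

Section Interpolation.
Variable G : series p k.+1.
Hypothesis Gsol : solution G.
Hypothesis Grow : forall m, height m = 0 -> G m = (m == 0)%:R.

(** When the row of height [0] of [G] is the impulse and [S] lies in one row,
    this agrees on that row with [x] on [S] and with [0] elsewhere. *)
Definition interpolant (S : seq 'rV[int]_k.+1) (x : series p k.+1) :=
  lop (seq_op S x) G.

Lemma interpolantE S x T m : uniq S -> (forall s, s \in S -> height s = T) ->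
  height m = T -> interpolant S x m = if m \in S then x m else 0.
Proof.
move=> uS hS hm; rewrite /interpolant seq_opE.
case: ifPn => [mS|nmS].
  rewrite (bigD1_seq m) //= subrr Grow ?eqxx ?mulr1; last first.
    by rewrite -(subrr (0 : 'rV_k.+1)) heightB subrr.
  rewrite big_seq_cond big1 ?addr0 // => s /andP[sS nes].
  rewrite Grow; last by rewrite heightB hm hS // subrr.
  by rewrite subr_eq0 eq_sym (negPf nes) mulr0.
rewrite big_seq big1 // => s sS.
rewrite Grow; last by rewrite heightB hm hS // subrr.
rewrite subr_eq0; case: eqP => [ms|]; last by rewrite mulr0.
by rewrite ms sS in nmS.
Qed.

Lemma interpolant_solution S x : solution (interpolant S x).
Proof. exact: solution_lop. Qed.
End Interpolation.

(** The equation of [solution] expresses a coordinate by coordinates of the next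
    row. *)
Lemma row_determines_point (j : nat) m : exists S : seq 'rV[int]_k.+1,
  (forall s, s \in S -> height s = height m + j%:Z) /\
  forall x, solution x -> (forall s, s \in S -> x s = 0) -> x m = 0.
Proof.
elim: j => [|j [S [hS SP]]].
  exists [:: m]; split=> [s|x _]; first by rewrite inE => /eqP->; rewrite addr0.
  by apply; rewrite mem_head.
exists [seq s + e - n | s <- S, n <- K]; split.
  move=> _ /allpairsP[[s n] /= [sS nK ->]].
  by rewrite heightB heightD (hS s sS) he (hK nK); lia.
move=> x xsol x0; apply: (SP x xsol) => s sS.
have -> : x s = act e x (s + e) by rewrite actE addrK.
rewrite xsol seq_opE big_seq big1 // => n nK.
by rewrite x0 ?mulr0 //; apply/allpairsP; exists (s, n).
Qed.

Lemma row_determines_window (W : seq 'rV[int]_k.+1) :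
  exists (S : seq 'rV[int]_k.+1) (T : int),
  [/\ uniq S, forall s, s \in S -> height s = T &
  forall x, solution x -> (forall s, s \in S -> x s = 0) ->
    forall m, m \in W -> x m = 0].
Proof.
have [T leT] : exists T : int, forall m, m \in W -> height m <= T.
  elim: W => [|m W [T leT]]; first by exists 0.
  exists (Num.max (height m) T) => n; rewrite inE le_max => /predU1P[->|/leT->].
    by rewrite lexx.
  by rewrite orbT.
suff [S hS SP] : exists2 S : seq 'rV[int]_k.+1,
    forall s, s \in S -> height s = T &
    forall x, solution x -> (forall s, s \in S -> x s = 0) ->
    forall m, m \in W -> x m = 0.
  exists (undup S), T; split; first exact: undup_uniq.
    by move=> s; rewrite mem_undup; exact: hS.
  by move=> x xsol x0; apply: SP => // s sS; apply: x0; rewrite mem_undup.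
elim: W leT => [|m W IHW] leT; first by exists [::].
have [|S hS SP] := IHW; first by move=> n nW; apply: leT; rewrite inE nW orbT.
have [S' [hS' S'P]] := row_determines_point (absz (T - height m)) m.
exists (S ++ S').
  move=> s; rewrite mem_cat => /orP[/hS//|/hS' ->].
  by have := leT _ (mem_head _ _); lia.
move=> x xsol x0 n; rewrite inE => /predU1P[->|nW].
  by apply: S'P => // s sS; apply: x0; rewrite mem_cat sS orbT.
by apply: SP => // s sS; apply: x0; rewrite mem_cat sS.
Qed.

Lemma seq_bounded (S : seq 'rV[int]_k.+1) :
  exists B : nat, forall s, s \in S -> forall i, (absz (s 0%R i) <= B)%N.
Proof.
elim: S => [|s S [B leB]]; first by exists 0%N.
exists (maxn (\sum_i absz (s 0%R i)) B)%N => s'.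
rewrite inE => /predU1P[->|s'S] i.
  by rewrite leq_max (bigD1 i) //= leq_addr.
by rewrite leq_max leB ?orbT.
Qed.

(** For a large power [q] of [p], the translates of a finite set by [q n], for
    distinct [n], are disjoint. *)
Lemma seq_separated (Hp : prime p) (S : seq 'rV[int]_k.+1) :
  exists j, forall s n n',
  s \in S -> s - n *+ (p ^ j) + n' *+ (p ^ j) \in S -> n = n'.
Proof.
have [B leB] := seq_bounded S; exists (B + B).+1 => s n n' sS s'S.
apply/rowP => i; apply: contrapT => nei.
have := leB _ s'S i; rewrite !mxE !mulmxnE; have := leB _ sS i.
have : (B + B < p ^ (B + B).+1)%N.
  by apply: ltn_trans (ltnSn _) _; apply: ltn_expl; exact: prime_gt1.
move: (p ^ _)%N => q.
have mz (z : int) : z *+ q = z * q%:Z by rewrite -mulr_natr natz.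
rewrite !mz.
move: (s 0 i) (n 0 i) (n' 0 i) nei => u v w nei ltq leu; apply/negP.
rewrite -ltnNge.
have -> : u - v * q + w * q = u - (v - w) * q by ring.
have le_q : (q <= absz ((v - w) * q%:Z)%R)%N.
  by rewrite abszM absz_nat leq_pmull // absz_gt0 subr_eq0; apply/eqP.
by move: ((v - w) * q%:Z) le_q => t; lia.
Qed.

Hypotheses (uK : uniq K) (c0 : forall n, n \in K -> c n != 0).
Variables k1 k2 : 'rV[int]_k.+1.
Hypotheses (k1K : k1 \in K) (k2K : k2 \in K) (nek : k1 != k2).

Lemma row_impulse_solution : exists2 G, solution G &
  forall m, height m = 0 -> G m = (m == 0)%:R.
Proof.
apply: (fundamental_solution uK _ c0 (@heightB k) he hK).
by case: K k1K.
Qed.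

Lemma solutionB x y : solution x -> solution y -> solution (x - y).
Proof.
rewrite /solution => xs ys.
by apply: (addIr (act e y)); rewrite -actD subrK xs ys -lopD subrK.
Qed.

Hypothesis Hp : prime p.
(** [F] stands for a continuous equivariant map of the space of solutions into
    itself fixing [0]; its values elsewhere are irrelevant. *)
Variable F : series p k.+1 -> series p k.+1.
Hypothesis Fsol : forall x, solution x -> solution (F x).
Hypothesis Fact : forall n x, solution x -> F (act n x) = act n (F x).
Hypothesis F0 : F 0 = 0.
Hypothesis Floc : forall x, solution x -> exists W : seq 'rV[int]_k.+1,
  forall z, solution z -> (forall m, m \in W -> z m = x m) -> F z 0 = F x 0.

Variable M : poly_model p k.+1 k.

Lemma local_on_row (xs : seq (series p k.+1)) :
  (forall x, x \in xs -> solution x) ->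
  exists (S : seq 'rV[int]_k.+1) (T : int),
  [/\ uniq S, forall s, s \in S -> height s = T &
  forall x z, x \in xs -> solution z -> (forall s, s \in S -> z s = x s) ->
    F z 0 = F x 0].
Proof.
move=> xsol.
have [W WP] : exists W : seq 'rV[int]_k.+1, forall x z, x \in xs -> solution z ->
    (forall m, m \in W -> z m = x m) -> F z 0 = F x 0.
  elim: xs xsol => [|x xs IHxs] xsol; first by exists [::].
  have [|W WP] := IHxs.
    by move=> y yxs; apply: xsol; rewrite inE yxs orbT.
  have [W' W'P] := Floc (xsol _ (mem_head _ _)).
  exists (W' ++ W) => y z; rewrite inE => /predU1P[->|yxs] zsol zy.
    by apply: W'P => // m mW; apply: zy; rewrite mem_cat mW.
  by apply: WP => // m mW; apply: zy; rewrite mem_cat mW orbT.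
have [S [T [uS hS SP]]] := row_determines_window W.
exists S, T; split=> // x z xxs zsol zx; apply: WP => // m mW.
apply/eqP; rewrite -subr_eq0; apply/eqP.
apply: (SP (z - x)) mW; first exact: solutionB (xsol _ _).
by move=> s sS; rewrite -[LHS]/(z s - x s) zx // subrr.
Qed.

(** A solution [z] is built whose translates by [q k1], by [q k2] and by [q n],
    for the other [n] in [K], agree with [x], [y] and [0] on a determining window
    [S].  By the Frobenius identity, its translate by [q e] agrees with
    [c_k1 x + c_k2 y] on [S]; the same identity for [F z] gives the result. *)
Lemma additive_two_terms x y : solution x -> solution y ->
  F (scale (c k1) x + scale (c k2) y) 0 = c k1 * F x 0 + c k2 * F y 0.
Proof.
move=> xsol ysol; pose w := scale (c k1) x + scale (c k2) y.
have wsol : solution w by apply: solutionD; exact: solution_lop.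
have [S [T [uS hS SP]]] : exists (S : seq 'rV[int]_k.+1) (T : int),
  [/\ uniq S, forall s, s \in S -> height s = T &
  forall v z, v \in [:: x; y; w; 0] -> solution z ->
    (forall s, s \in S -> z s = v s) -> F z 0 = F v 0].
  apply: local_on_row => v; rewrite !inE => /or4P[] /eqP-> //; exact: solution0.
have [j sep] := seq_separated Hp S; set q := (p ^ j)%N in sep.
have [G Gsol Grow] := row_impulse_solution.
pose ux := interpolant G S x; pose uy := interpolant G S y.
pose z := act (- (k1 *+ q)) ux + act (- (k2 *+ q)) uy.
have zsol : solution z.
  by apply: solutionD; apply: solution_act; exact: interpolant_solution.
have uE v (n n' : 'rV[int]_k.+1) s : n \in K -> n' \in K -> s \in S ->
    act (n *+ q) (act (- (n' *+ q)) (interpolant G S v)) s =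
    if n == n' then v s else 0.
  move=> nK n'K sS; rewrite !actE opprK.
  rewrite (interpolantE Grow v uS hS); last first.
    rewrite heightD heightB (height_mulrn q (hK nK)) (height_mulrn q (hK n'K)).
    by rewrite subr0 addr0 hS.
  case: eqVneq => [->|nen]; first by rewrite subrK sS.
  by case: ifPn => // /(sep _ _ _ sS) eqn; rewrite eqn eqxx in nen.
have zE n s : n \in K -> s \in S -> act (n *+ q) z s =
    (if n == k1 then x s else 0) + (if n == k2 then y s else 0).
  by move=> nK sS; rewrite actD -[LHS]/(_ s + _ s) !uE.
have FE n : n \in K -> F (act (n *+ q) z) 0 =
    if n == k1 then F x 0 else if n == k2 then F y 0 else 0.
  move=> nK; have nsol := solution_act (n *+ q) zsol.
  case: ifPn => [/eqP nk1|nk1].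
    apply: SP => // [|s sS]; first by rewrite !inE eqxx.
    by rewrite zE // nk1 eqxx (negPf nek) addr0.
  case: ifPn => [/eqP nk2|nk2].
    apply: SP => // [|s sS]; first by rewrite !inE eqxx orbT.
    by rewrite zE // (negPf nk1) nk2 eqxx add0r.
  rewrite -[RHS]/((0 : series p k.+1) 0) -F0.
  apply: SP => // [|s sS]; first by rewrite !inE eqxx !orbT.
  by rewrite zE // (negPf nk1) (negPf nk2) addr0.
have sum2 (f : 'rV[int]_k.+1 -> 'F_p) (u v : 'F_p) :
    (forall n, n \in K ->
      f n = if n == k1 then u else if n == k2 then v else 0) ->
    \sum_(n <- K) c n * f n = c k1 * u + c k2 * v.
  move=> fE; rewrite (bigD1_seq k1) //= (fE _ k1K) eqxx; congr (_ + _).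
  rewrite (big_rem k2) //= eq_sym nek fE // eqxx eq_sym (negPf nek).
  rewrite big_seq_cond big1 ?addr0 // => n /andP[].
  rewrite mem_rem_uniq // => /andP[/= nk2 nK] nk1.
  by rewrite fE // (negPf nk1) (negPf nk2) mulr0.
have <- : F (act (e *+ q) z) 0 = F w 0.
  apply: SP; [by rewrite !inE eqxx !orbT|exact: solution_act|].
  move=> s sS; rewrite (frobenius_identity M hK Hp j zsol) fct_sumE.
  rewrite -[w s]/(scale _ _ s + scale _ _ s) !scaleE.
  rewrite -(@sum2 (fun n => act (n *+ q) z s)).
    by apply: eq_bigr => n _; rewrite scaleE.
  move=> n nK; rewrite zE //; case: ifPn => [/eqP->|nk1].
    by rewrite (negPf nek) addr0.
  by rewrite add0r.
rewrite Fact // (frobenius_identity M hK Hp j (Fsol zsol)) fct_sumE.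
rewrite -(@sum2 (fun n => F (act (n *+ q) z) 0)) //.
by apply: eq_bigr => n _; rewrite scaleE Fact.
Qed.

Lemma scaleK b x : b != 0 -> scale b (scale b^-1 x) = x.
Proof. by move=> b0; apply/funext => m; rewrite !scaleE mulVKf. Qed.

Lemma local_rule_additive x y : solution x -> solution y ->
  F (x + y) 0 = F x 0 + F y 0.
Proof.
move=> xsol ysol.
have s0 b : scale b (0 : series p k.+1) = 0 by exact: lop0.
have F00 : F 0 0 = 0 by rewrite F0.
have E n z : solution z -> solution (scale (c n) z) by exact: solution_lop.
have := additive_two_terms (solution_lop (term0 _ (c k1)^-1) xsol)
  (solution_lop (term0 _ (c k2)^-1) ysol).
rewrite -!/(scale _ _) !scaleK ?c0 // => ->; congr (_ + _).
  have := additive_two_terms (solution_lop (term0 _ (c k1)^-1) xsol) solution0.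
  by rewrite -!/(scale _ _) s0 addr0 scaleK ?c0 // F00 mulr0 addr0.
have := additive_two_terms solution0 (solution_lop (term0 _ (c k2)^-1) ysol).
by rewrite -!/(scale _ _) s0 add0r scaleK ?c0 // F00 mulr0 add0r.
Qed.

Lemma local_rule_scale b x : solution x -> F (scale b x) 0 = b * F x 0.
Proof.
move=> xsol; rewrite scale_natr -{2}(natr_Zp b) mulr_natl.
elim: (b : nat) => [|j IHj]; first by rewrite F0.
rewrite !mulrS local_rule_additive ?IHj //.
by elim: j {IHj} => [|j IHj]; [exact: solution0|rewrite mulrS; exact: solutionD].
Qed.

Lemma local_rule_sum (S : seq 'rV[int]_k.+1) (b : 'rV[int]_k.+1 -> 'F_p) x :
  solution x -> F (lop (seq_op S b) x) 0 = \sum_(s <- S) b s * F (act s x) 0.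
Proof.
move=> xsol; elim: S => [|s S IHS]; first by rewrite lop_nil F0 big_nil.
rewrite big_cons -IHS -local_rule_scale; last exact: solution_act.
rewrite -local_rule_additive.
- congr (F _ 0); apply/funext => m.
  rewrite -[RHS]/(scale _ _ m + lop (seq_op S b) x m).
  by rewrite scaleE actE !seq_opE big_cons.
- by apply: solution_lop; exact: solution_act.
- exact: solution_lop.
Qed.

(** The coefficient of exponent [- s] of the Laurent polynomial is the value at
    the origin of [F] on a solution whose row through [s] is the impulse at
    [s]. *)
Theorem equivariant_map_is_laurent :
  exists t, forall x, solution x -> F x = lop t x.
Proof.
have [S [T [uS hS SP]]] : exists (S : seq 'rV[int]_k.+1) (T : int),
  [/\ uniq S, forall s, s \in S -> height s = T &
  forall v z, v \in [:: 0] -> solution z ->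
    (forall s, s \in S -> z s = v s) -> F z 0 = F v 0].
  by apply: local_on_row => v; rewrite mem_seq1 => /eqP ->; exact: solution0.
have [G Gsol Grow] := row_impulse_solution.
exists [seq (F (act s G) 0, - s) | s <- S] => x xsol.
have F_at0 z : solution z -> F z 0 = \sum_(s <- S) F (act s G) 0 * z s.
  move=> zsol; have isol := interpolant_solution Gsol S z.
  have -> : F z 0 = F (interpolant G S z) 0.
    rewrite -[z in LHS](subrK (interpolant G S z)) local_rule_additive //.
      rewrite [X in X + _](_ : _ = 0) ?add0r //.
      rewrite -[RHS]/((0 : series p k.+1) 0) -F0.
      apply: SP; [by rewrite mem_head|exact: solutionB|move=> s sS].
      rewrite -[LHS]/(z s - interpolant G S z s).
      by rewrite (interpolantE Grow z uS hS (hS _ sS)) sS subrr.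
    exact: solutionB.
  by rewrite local_rule_sum //; apply: eq_bigr => s _; rewrite mulrC.
apply/funext => m; rewrite /lop big_map.
have -> : F x m = F (act (- m) x) 0 by rewrite Fact // actE sub0r opprK.
rewrite F_at0; last exact: solution_act.
by apply: eq_bigr => s _; rewrite actE !opprK addrC.
Qed.
End Rigidity.

(** * Automorphisms as fractions of polynomials *)

Lemma additive_val_exp (M : idomainType) (v : M -> nat) a j :
  additive_val v -> a != 0 -> v (a ^+ j) = (j * v a)%N.
Proof.
move=> vM a0; elim: j => [|j IHj].
  have := vM 1 1 (oner_neq0 _) (oner_neq0 _).
  rewrite mulr1 expr0 => /eqP.
  by rewrite -{1}[v 1]addn0 eqn_add2l eq_sym => /eqP.
by rewrite exprS vM ?inE ?expf_neq0 // IHj mulSn.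
Qed.

Section Localizer.
Variables (p k : nat) (K : seq 'rV[int]_k.+1) (c : 'rV[int]_k.+1 -> 'F_p).
Hypothesis hK : forall n, n \in K -> height n = 0.
Variable e : 'rV[int]_k.+1.
Hypothesis he : height e = 1.
Variable M : poly_model p k.+1 k.
Implicit Types (x y z : series p k.+1) (m n : 'rV[int]_k.+1).
Local Notation mop a := (lop (@pm_op _ _ _ M a)).
Local Notation solution := (solution K c e).

(** Some polynomial [Psi] in all variables but the last acts on solutions as a
    monomial, and clears the denominators of all Laurent monomials, the last
    variable included.  It is [Y^(N+1) Phi] where [Y] is the product of the
    variables but the last, [Phi] is the Laurent polynomial with support [K] and
    coefficients [c], and [Y^N Phi] is a polynomial. *)
Lemma localizer_exists : exists (Psi : M) (n0 : 'rV[int]_k.+1),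
  (forall x, solution x -> mop Psi x = act n0 x) /\
  forall n, exists N a, forall x, solution x ->
    mop (Psi ^+ N) (act n x) = mop a x.
Proof.
have [N /(_ N (leqnn N))[f fP]] := seq_op_shift M hK.
pose A : M := \sum_(n <- K) (c n : nat)%:R * f n.
have AE y : mop A y = act (ones k *+ N) (lop (seq_op K c) y).
  exact: pm_op_shifted_sum fP.
move: A AE => {f fP} A AE.
have Asol x : solution x -> mop A x = act (ones k *+ N + e) x.
  by move=> xs; rewrite AE -xs act_act.
have [Y YE] : exists Y : M, forall x, mop Y x = act (ones k) x.
  apply: pm_monom => i leki; first by rewrite mxE leki.
  by rewrite mxE ltnNge leki.
(* On solutions [A] acts as [Y^N X^e], so [Y * A] acts as the monomial [n0]. *)
pose n0 := ones k *+ N.+1 + e.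
have exp_sol (B : M) n x j : (forall y, solution y -> mop B y = act n y) ->
    solution x -> mop (B ^+ j) x = act (n *+ j) x.
  move=> BP xs; apply: lop_pm_exp => i; apply: BP; exact: solution_act.
have Psol x : solution x -> mop (Y * A) x = act n0 x.
  by move=> xs; rewrite pm_opM Asol // YE act_act /n0 mulrS addrA.
exists (Y * A), n0; split=> // n.
have mzE (B : 'rV[int]_k.+1) (u : int) i : (B *~ u) 0 i = B 0 i * u.
  by case: u => u; rewrite ?NegzE ?mulrNz ?mxE mulmxnE -mulr_natr natz ?mulrN.
pose n' := n - e *~ height n.
have hez (i : int) : height (e *~ i) = i.
  by rewrite /height mzE -/(height e) he mul1r.
have hn' : height n' = 0 by rewrite heightB hez subrr.
have [N0 N0P] := monom_shift M hn'.
pose h := absz (height n).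
(* Large enough for the exponents [j] of [A] and [r] of [Y] below to be
   nonnegative, with [r >= N0]. *)
pose N' := (N * h + h + N0)%N.
have leNh : N%:Z * height n <= (N * h)%N.
  by rewrite PoszM ler_wpM2l //; rewrite /h; lia.
have [j jE] : exists j : nat, j%:Z = N'%:Z + height n.
  by exists (absz (N'%:Z + height n)%R); rewrite /N' /h; lia.
have [r rE] : exists r : nat, r%:Z = N'%:Z - N%:Z * height n.
  exists (absz (N'%:Z - N%:Z * height n)%R).
  by rewrite /N'; move: (_ * height n) (N * h)%N leNh => u t; lia.
have [|a aP] := N0P r.
  by rewrite -lez_nat rE /N'; move: (_ * height n) (N * h)%N leNh => u t; lia.
exists N', (A ^+ j * a) => x xs.
rewrite (exp_sol (Y * A) n0 _ N') //; last exact: solution_act.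
rewrite pm_opM aP.
rewrite (exp_sol A (ones k *+ N + e) _ j Asol (solution_act _ xs)).
rewrite !act_act; congr (act _ x).
rewrite /n0 /n'; apply/rowP => i.
have mnE (z : int) (u : nat) : z *+ u = z * u%:Z by rewrite -mulr_natr natz.
rewrite !(mxE, mulmxnE) !mzE !mnE jE rE intS.
ring.
Qed.

End Localizer.

Section Units.
Variables (p k : nat) (Hp : prime p) (P : laurent p k.+1).
Variables (K : seq 'rV[int]_k.+1) (c : 'rV[int]_k.+1 -> 'F_p).
Hypotheses (uK : uniq K) (c0 : forall n, n \in K -> c n != 0).
Hypothesis hK : forall n, n \in K -> height n = 0.
Variables (e k1 k2 : 'rV[int]_k.+1).
Hypotheses (he : height e = 1).
Hypotheses (k1K : k1 \in K) (k2K : k2 \in K) (nek : k1 != k2).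
Hypothesis perpE : forall x, perp P x <-> solution K c e x.
Variable M : poly_model p k.+1 k.
Implicit Types (f g : automorphism P) (x y z : series p k.+1).
Implicit Types m n s : 'rV[int]_k.+1.
Local Notation solution := (solution K c e).
Local Notation mop a := (lop (@pm_op _ _ _ M a)).

Lemma perp_solution (x : perp P) : solution (\val x).
Proof. by apply/perpE; exact: set_valP. Qed.

Lemma solution_perp x : solution x -> exists y : perp P, \val y = x.
Proof. by move=> /perpE xP; exists (SigSub (mem_set xP)). Qed.

Lemma aut_is_laurent f : exists t, forall x : perp P, \val (f x) = lop t (\val x).
Proof.
pose F x : series p k.+1 := if pselect (perp P x) is left xP
  then \val (f (SigSub (mem_set xP))) else 0.
have FE (x : perp P) : F (\val x) = \val (f x).
  rewrite /F; case: pselect => [xP|]; last by case; exact: set_valP.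
  by congr (\val (f _)); exact: val_inj.
have [homf fT f0] := aut_funP f.
have [||||t tP] := @equivariant_map_is_laurent p k K c hK e he uK c0 k1 k2 k1K k2K
  nek Hp F _ _ _ _ M.
- by move=> x /solution_perp[y <-]; rewrite FE; exact: perp_solution.
- move=> n x /solution_perp[y <-]; rewrite FE.
  by rewrite -[act n (\val y)]/(\val (perp_T n y)) FE fT.
- by rewrite -[0]/(\val (perp0 P)) FE f0.
- move=> x /solution_perp[y <-]; case: homf => g [_ _ cf _].
  have [W WP] := continuous_finite_window cf y.
  exists W => z /solution_perp[y' <-] agr; rewrite !FE; exact: WP.
by exists t => x; rewrite -FE tP //; exact: perp_solution.
Qed.

Lemma automorphism_abelian : abelian_group (automorphism P).
Proof.
move=> f g; apply: aut_ext => x; apply: val_inj.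
have [t tP] := aut_is_laurent f; have [u uP] := aut_is_laurent g.
by rewrite /= tP !uP tP lopC.
Qed.

(** For [G] with the impulse as row of height [0], the row of height [0] of [a G]
    is the impulse response of [a]. *)
Lemma pm_faithful (a b : M) :
  (forall x, solution x -> mop a x = mop b x) -> a = b.
Proof.
move=> ab; apply/eqP; rewrite -subr_eq0; apply/eqP/pm_inj.
have [G Gsol Grow] := row_impulse_solution hK he uK c0 k1K.
have abG : mop (a - b) G = 0.
  have bG : mop (- b) G + mop b G = 0 by rewrite -pm_opD addNr pm_op0.
  by rewrite pm_opD ab // addrC.
have h0 t : t \in pm_op (a - b) -> height t.2 = 0.
  by move=> tab; rewrite /height (pm_supp tab).
apply/funext => m; have [hm|hm] := eqVneq (height m) 0; last first.
  apply: contraNeq hm => /lop_impulse[t tab ->]; apply/eqP; exact: h0.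
rewrite -[RHS]/((0 : series p k.+1) m) -abG /lop big_seq [RHS]big_seq.
apply: eq_bigr => t tab; rewrite Grow //.
by rewrite heightB hm (h0 t tab) subrr.
Qed.

Variables (Psi : M) (n0 : 'rV[int]_k.+1).
Hypothesis Psol : forall x, solution x -> mop Psi x = act n0 x.
Hypothesis Pclear : forall n, exists N a, forall x, solution x ->
  mop (Psi ^+ N) (act n x) = mop a x.

Lemma localizer_neq0 : Psi != 0.
Proof.
have [G Gsol Grow] := row_impulse_solution hK he uK c0 k1K.
apply/eqP => P0; have := Psol Gsol; rewrite P0 pm_op0.
move/(congr1 (fun x : series p k.+1 => x n0)); rewrite actE subrr Grow.
  by rewrite eqxx => /eqP; rewrite eq_sym oner_eq0.
by rewrite /height mxE.
Qed.

Lemma lop_clear t : exists N a, forall x, solution x ->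
  mop (Psi ^+ N) (lop t x) = mop a x.
Proof.
elim: t => [|[b n] t [N [a aP]]].
  by exists 0%N, 0 => x _; rewrite lop_nil lop0 pm_op0.
have [N' [a' a'P]] := Pclear n.
exists (N + N')%N, ((b : nat)%:R * (Psi ^+ N * a') + Psi ^+ N' * a) => x xs.
have -> : lop ((b, n) :: t) x = scale b (act n x) + lop t x.
  apply/funext => m; rewrite -[RHS]/(scale _ _ m + _ m) scaleE actE.
  by rewrite /lop big_cons.
rewrite lopD !pm_opD !pm_opM pm_op_scale exprD -(a'P x) // -(aP x) //.
rewrite {2}[Psi ^+ N * _]mulrC !pm_opM; congr (_ + _).
rewrite /scale (lopC (pm_op (Psi ^+ N')) (term0 _ b)).
by rewrite (lopC (pm_op (Psi ^+ N))).

Qed.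

(** [f] acts on solutions as the fraction [a / Psi ^+ N]. *)
Definition represented f (a : M) (N : nat) := forall x : perp P,
  mop (Psi ^+ N) (\val (f x)) = mop a (\val x).

Lemma represented_exists f : exists a N, represented f a N.
Proof.
have [t tP] := aut_is_laurent f; have [N [a aP]] := lop_clear t.
by exists a, N => x; rewrite tP aP //; exact: perp_solution.
Qed.

Lemma representedM f g a b N N' : represented f a N -> represented g b N' ->
  represented (f * g)%g (a * b) (N + N').
Proof.
move=> fa gb x; rewrite exprD mulrC !pm_opM /= fa lopC gb.
by [].
Qed.

Lemma represented1 N : represented 1%g (Psi ^+ N) N.
Proof. by []. Qed.

Lemma represented_eq f a b N N' : represented f a N -> represented f b N' ->
  Psi ^+ N' * a = Psi ^+ N * b.
Proof.
move=> fa fb; apply: pm_faithful => _ /solution_perp[x <-].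
by rewrite !pm_opM -fa -fb lopC.
Qed.

Lemma representedV f a b N N' : represented f a N -> represented f^-1%g b N' ->
  a * b = Psi ^+ (N + N').
Proof.
move=> fa fb; have := representedM fa fb; rewrite mulgV => ab.
have := represented_eq ab (represented1 0).
by rewrite expr0 mul1r mulr1.
Qed.

(** The homomorphisms to the integers send [a / Psi ^+ N] to
    [v a - N * v Psi], for the additive functions [v] attached to [Psi].  An
    automorphism in their common kernel acts as an element of the finite set
    [Z]. *)
Theorem automorphism_fg : finitely_generated_group (automorphism P).
Proof.
have P0 := localizer_neq0.
have [Z ZP] := @pm_val _ _ _ M; have [r [v [vM vP]]] := ZP Psi P0.
have rex f : {aN : M * nat | represented f aN.1 aN.2}.
  by apply: cid; have [a [N aN]] := represented_exists f; exists (a, N).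
pose num f := (sval (rex f)).1; pose den f := (sval (rex f)).2.
have repP f : represented f (num f) (den f) by exact: svalP (rex f).
have numV f : num f * num f^-1%g = Psi ^+ (den f + den f^-1%g).
  exact: representedV.
have num0 f : num f != 0.
  have := expf_neq0 (den f + den f^-1%g) P0; rewrite -numV mulf_eq0 negb_or.
  by case/andP.
pose w i f : int := (v i (num f))%:Z - (den f)%:Z * (v i Psi)%:Z.
apply: (@finitely_generated_of_homs _ r w).
  move=> i f g.
  have := represented_eq (repP (f * g)%g) (representedM (repP f) (repP g)).
  move/(congr1 (v i)); rewrite !vM ?inE ?expf_neq0 ?mulf_neq0 ?num0 //.
  rewrite !additive_val_exp // /w => /(congr1 Posz).
  rewrite !PoszD !PoszM !PoszD.
  by move: (v i _) (v i _) (v i _) (v i _) => *; lia.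
pose fit (z : M) f := forall x : perp P, \val (f x) = mop z (\val x).
have pick (z : M) : {f | (exists g, fit z g) -> fit z f}.
  apply: cid; have [[g gz]|no] := pselect (exists g, fit z g); last by exists 1%g.
  by exists g.
exists [seq sval (pick b) | b <- Z] => f wf.
have [i|z zZ numz] := vP (den f + den f^-1%g)%N (num f) (Psi ^+ den f)
  (num f^-1%g) (Psi ^+ den f^-1%g) (numV f) (esym (exprD _ _ _)).
  by rewrite additive_val_exp //; have := wf i; rewrite /w; lia.
have fz : fit z f.
  move=> x; apply: (@act_inj _ _ (n0 *+ den f)).
  have ex y : solution y -> mop (Psi ^+ den f) y = act (n0 *+ den f) y.
    move=> ys; apply: lop_pm_exp => i; apply: Psol; exact: solution_act.
  rewrite -!ex; last 2 first.
  - by apply: solution_lop; exact: perp_solution.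
  - exact: perp_solution.
  by rewrite repP numz pm_opM lopC.
apply/mapP; exists z => //; apply: aut_ext => x; apply: val_inj.
have zf := svalP (pick z) (ex_intro _ f fz).
by rewrite fz zf.
Qed.
End Units.

(** * The case of a linear cellular automaton shift *)

Section LinearCA.
Variables (p k : nat).
Implicit Types (P Q : laurent p k.+1) (Phi : laurent p k).

Lemma lmul_widen (P : laurent p k.+1) (D : seq 'rV[int]_k.+1) x m : uniq D ->
  {subset msupp P <= D} -> lmul P x m = \sum_(n <- D) P@_n * x (m - n).
Proof.
move=> uD sub; rewrite [RHS](bigID (mem (msupp P))) /= [X in _ + X]big1 ?addr0.
  rewrite -big_filter; apply: perm_big; apply: uniq_perm.
  - exact: fset_uniq.
  - exact: filter_uniq.
  - move=> n; rewrite mem_filter /=.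
    by case: (boolP (n \in msupp P)) => // /sub ->.
by move=> n /mcoeff_outdom ->; rewrite mul0r.
Qed.

Lemma lmulB P Q x : lmul (P - Q) x = lmul P x - lmul Q x.
Proof.
pose D := undup (msupp P ++ msupp Q ++ msupp (P - Q)).
have wid (R : laurent p k.+1) m :
    {subset msupp R <= msupp P ++ msupp Q ++ msupp (P - Q)} ->
    lmul R x m = \sum_(n <- D) R@_n * x (m - n).
  move=> sub; apply: lmul_widen; first exact: undup_uniq.
  by move=> n /sub; rewrite mem_undup.
apply/funext => m; rewrite -[RHS]/(lmul P x m - lmul Q x m).
rewrite (wid P m) => [|n nP]; last by rewrite mem_cat nP.
rewrite (wid Q m) => [|n nQ]; last by rewrite !mem_cat nQ orbT.
rewrite (wid (P - Q) m) => [|n nPQ]; last by rewrite !mem_cat nPQ !orbT.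
by rewrite -sumrB; apply: eq_bigr => n _; rewrite mcoeffB mulrBl.
Qed.

(** The exponent of the last variable. *)
Definition lastX_exp : 'rV[int]_k.+1 := \row_(i < k.+1) (i.+1 == k.+1)%:R.

Lemma height_lastX : height lastX_exp = 1.
Proof. by rewrite /height mxE eqxx. Qed.

Lemma perp_lca Phi x : perp (lca_poly (d := k.+1) Phi) x <->
  solution (msupp (lift_laurent (d := k.+1) Phi))
    (fun n => (lift_laurent (d := k.+1) Phi)@_n) lastX_exp x.
Proof.
rewrite /perp /= /lca_poly lmulB /solution.
have -> : lmul (lastX p k.+1) x = act lastX_exp x by [].
have -> : lop (seq_op (msupp (lift_laurent (d := k.+1) Phi))
    (fun n => (lift_laurent (d := k.+1) Phi)@_n)) x
    = lmul (lift_laurent (d := k.+1) Phi) x.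
  by apply/funext => m; rewrite seq_opE.
split; first by move/eqP; rewrite subr_eq0 => /eqP.
by move=> ->; rewrite subrr.
Qed.

Lemma lift_expE (n : 'rV[int]_k) (j : 'I_k) :
  lift_exp (d := k.+1) n 0 (widen_ord (leqnSn k) j) = n 0 j.
Proof.
rewrite mxE /=; case: insubP => [i _ ij|]; last by rewrite ltn_ord.
by congr (n 0 _); exact: val_inj.
Qed.

Lemma lift_exp_inj : injective (lift_exp (d := k.+1)).
Proof.
move=> n n' eqn; apply/rowP => j.
by rewrite -lift_expE eqn lift_expE.
Qed.

Lemma height_lift (n : 'rV[int]_k) : height (lift_exp (d := k.+1) n) = 0.
Proof. by rewrite /height mxE insubF //= ltnn. Qed.

Lemma lift_coef Phi (n : 'rV[int]_k.+1) :
  (lift_laurent (d := k.+1) Phi)@_n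
  = \sum_(j <- msupp Phi) Phi@_j *+ (lift_exp (d := k.+1) j == n).
Proof.
rewrite /lift_laurent raddf_sum; apply: eq_bigr => j _.
by rewrite /= mcoeffU.
Qed.

Lemma lift_supp Phi (n : 'rV[int]_k.+1) :
  n \in msupp (lift_laurent (d := k.+1) Phi) -> height n = 0.
Proof.
rewrite -mcoeff_neq0 lift_coef => nz.
have [[j jn]|no] := pselect (exists j, lift_exp (d := k.+1) j = n).
  by rewrite -jn height_lift.
case/eqP: nz; rewrite big1 // => j _; case: eqP => [jn|//].
by case: no; exists j.
Qed.

Lemma lift_supp_exp Phi (j : 'rV[int]_k) : j \in msupp Phi ->
  lift_exp (d := k.+1) j \in msupp (lift_laurent (d := k.+1) Phi).
Proof.
move=> jP; rewrite -mcoeff_neq0 lift_coef (bigD1_seq j) ?fset_uniq //= eqxx.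
rewrite big1 ?addr0 ?mcoeff_neq0 // => i neij.
by rewrite (inj_eq lift_exp_inj) (negPf neij).
Qed.

End LinearCA.

Theorem corollary15 (p d : nat) (Hp : prime p) (Hd : (2 <= d)%N)
    (Phi : laurent p d.-1) (HPhi : (2 <= nb_terms Phi)%N) :
  abelian_group (automorphism (lca_poly Phi)) /\
  finitely_generated_group (automorphism (lca_poly Phi)).
Proof.
case: d Hd Phi HPhi => // k _ /= Phi HPhi.
have [j1 [j2 [j1P j2P nej]]] : exists j1 j2,
    [/\ j1 \in msupp Phi, j2 \in msupp Phi & j1 != j2].
  move: HPhi (fset_uniq (msupp Phi)); rewrite /nb_terms.
  have mE j : (j \in msupp Phi) = (j \in (msupp Phi : seq _)) by [].
  case E: (msupp Phi : seq _) => [|j1 [|j2 s]] //= _ /andP[].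
  rewrite inE negb_or => /andP[nej _] _; exists j1, j2.
  by rewrite !mE E !inE !eqxx orbT.
have [M] := poly_model_exists p (leqnSn k).
have nel : lift_exp (d := k.+1) j1 != lift_exp (d := k.+1) j2.
  by rewrite (inj_eq (@lift_exp_inj k)).
have cP n : n \in msupp (lift_laurent (d := k.+1) Phi) ->
  (lift_laurent (d := k.+1) Phi)@_n != 0 by rewrite mcoeff_neq0.
split.
  exact: (automorphism_abelian Hp (fset_uniq _) cP (@lift_supp p k Phi)
    (@height_lastX k) (lift_supp_exp j1P) (lift_supp_exp j2P) nel
    (perp_lca _) M).
have [Psi [n0 [PsiP Pclear]]] := @localizer_exists p k _
  (fun n => (lift_laurent (d := k.+1) Phi)@_n) (@lift_supp p k Phi) _
  (@height_lastX k) M.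
exact: (automorphism_fg Hp (fset_uniq _) cP (@lift_supp p k Phi)
    (@height_lastX k) (lift_supp_exp j1P) (lift_supp_exp j2P) nel
    (perp_lca _) PsiP Pclear).
Qed.
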